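(* Let $p>1$, $a\in\mathbb{C}$ with $0<|a|<1$, $M\in\mathbb{N}$ (a positive integer), and $\varphi(z)=az^M$. Then the spectrum of $D_\varphi$ acting on $S^p$ is $$\sigma(D_\varphi)=\begin{cases}\{0,2a\} & \text{if } M=2,\\ \{0\} & \text{otherwise.}\end{cases}$$
   Context: $\mathbb{D}$ is the open unit disk. For $p>1$, $H^p$ is the Hardy space on $\mathbb{D}$ with norm $\|g\|_{H^p}^p=\sup_{0<r<1}\int_0^{2\pi}|g(re^{i\theta})|^p\frac{d\theta}{2\pi}$; $S^p$ is the space of analytic $f$ on $\mathbb{D}$ with $f'\in H^p$, normed by $\|f\|_{S^p}=|f(0)|+\|f'\|_{H^p}$. $D_\varphi f=f'\circ\varphi$. *)

(* Defs.v *)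
From Stdlib Require Import Reals ClassicalEpsilon.
From Coquelicot Require Import Coquelicot.
Open Scope R_scope.

(* real power with the convention x^q = 0 for x <= 0 (only used for x >= 0, q > 0) *)
Definition rpow (x q : R) : R := if Rle_dec x 0 then 0 else Rpower x q.

Definition in_disk (z : C) : Prop := Cmod z < 1.

Definition cderiv_at (f : C -> C) (z l : C) : Prop :=
  @is_derive C_AbsRing C_NormedModule f z l.

Definition analytic_disk (f : C -> C) : Prop :=
  forall z, in_disk z -> exists l, cderiv_at f z l.

(* the complex derivative f' (chosen; meaningful where f is differentiable) *)
Definition Cderiv (f : C -> C) (z : C) : C :=
  epsilon (inhabits (0%R, 0%R)) (fun l => cderiv_at f z l).

Definition Mp (p : R) (g : C -> C) (r : R) : R :=
  / (2 * PI) * RInt (fun t => rpow (Cmod (g (r * cos t, r * sin t))) p) 0 (2 * PI).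

Definition in_Hp (p : R) (g : C -> C) : Prop :=
  analytic_disk g /\ exists K, forall r, 0 < r < 1 -> Mp p g r <= K.

Definition Hp_norm (p : R) (g : C -> C) : R :=
  rpow (real (Lub_Rbar (fun x => exists r, 0 < r < 1 /\ x = Mp p g r))) (/ p).

Definition in_Sp (p : R) (f : C -> C) : Prop :=
  analytic_disk f /\ in_Hp p (Cderiv f).

Definition Sp_norm (p : R) (f : C -> C) : R :=
  Cmod (f (0%R, 0%R)) + Hp_norm p (Cderiv f).

Definition phi_sym (a : C) (M : nat) (z : C) : C := Cmult a (@pow_n C_Ring z M).

Definition D_phi (phi : C -> C) (f : C -> C) : C -> C := fun z => Cderiv f (phi z).

(* T is an invertible element of the algebra of bounded operators on S^p:
   T maps S^p to S^p, is bounded, bounded below (so injective with bounded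
   inverse) and onto S^p (functions identified when they agree on D). *)
Definition invertible_on_Sp (p : R) (T : (C -> C) -> (C -> C)) : Prop :=
  (forall f, in_Sp p f -> in_Sp p (T f)) /\
  (exists K, forall f, in_Sp p f -> Sp_norm p (T f) <= K * Sp_norm p f) /\
  (exists K, forall f, in_Sp p f -> Sp_norm p f <= K * Sp_norm p (T f)) /\
  (forall g, in_Sp p g -> exists f, in_Sp p f /\ forall z, in_disk z -> T f z = g z).

Definition spectrum_Sp (p : R) (T : (C -> C) -> (C -> C)) (lam : C) : Prop :=
  ~ invertible_on_Sp p (fun f z => Cminus (T f z) (Cmult lam (f z))).

(* Main.v *)
Require Import Defs.
From Stdlib Require Import Reals Lra Lia Psatz ClassicalEpsilon.
From Coquelicot Require Import Coquelicot.
Open Scope R_scope.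
Set Bullet Behavior "Strict Subproofs".

(* On Taylor coefficients, D_phi acts as the weighted shift
   (T c)_m = e_m c_(m/M + 1), where e_m = (m/M + 1) a^(m/M) if M divides m and e_m = 0 otherwise.
   A function of S^p has bounded coefficients, and since e_m decays geometrically, T maps bounded
   sequences to coefficients of functions with bounded derivative on the disk.  Hence
   D_phi - lam is invertible on S^p as soon as T - lam is invertible on bounded sequences, because
   a solution of (D_phi - lam) f = g satisfies f = (D_phi f - g) / lam.
   For lam <> 0 the equation reads c_m = u_m + v_m c_(m/M + 1) with v_m -> 0; a change of weights
   makes the shift a contraction, except for the fixed index m = 2 of m |-> m/M + 1 when M = 2,
   where one divides by 2a - lam.  The remaining points 0 and 2a are eigenvalues, with
   eigenfunctions 1 and z^2. *)

(** Functions are given by complex differentiability alone, so the passage to coefficients has to be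
    earned. Membership in S^p makes [f] and its derivative differentiable, hence the derivative
    continuous, and this is enough to prove Cauchy's formula by differentiating an integral under
    the sign. The integrals in the definitions are real. Complex identities are therefore stated as
    real ones for [Re (k * x)] with an arbitrary complex [k]: the choices 1 and -i recover both
    parts, a conjugate phase recovers the modulus. Inverting the shift only yields bounded
    coefficients, and these alone do not give a function in S^p. The way back is [Sp_dominated]: if
    the coefficients of one function are L times those of another, up to an error of at most B E_m
    with m E_m summable, then its derivative is L times the other derivative plus a bounded
    function. It serves with L = -lam for the operator, L = -1/lam for its inverse and L = 0 for
    eigenfunctions. It applies to E_m = |e_m| because, with integer division in the exponent,
    |a|^(m/M) is at most a constant times the m-th power of |a|^(1/M) < 1. *)

Lemma re_minus (x y : C) : Re (x - y) = Re x - Re y.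
Proof. reflexivity. Qed.

Lemma im_minus (x y : C) : Im (x - y) = Im x - Im y.
Proof. reflexivity. Qed.

Lemma im_le_Cmod (z : C) : Rabs (Im z) <= Cmod z.
Proof. exact (Rle_trans _ _ _ (Rmax_r _ _) (Rmax_Cmod z)). Qed.

Lemma Cmod_le_Re_Im (z : C) : Cmod z <= Rabs (Re z) + Rabs (Im z).
Proof.
  destruct z as [x y]; unfold Re, Im; simpl.
  replace (x, y) with (Cplus (RtoC x) (Cmult Ci (RtoC y))).
  2: { unfold Cplus, Cmult, Ci, RtoC; simpl; f_equal; ring. }
  eapply Rle_trans; [apply Cmod_triangle|].
  rewrite Cmod_mult, !Cmod_R, Cmod_Ci; lra.
Qed.

Lemma Cmod_minus_sym (x y : C) : Cmod (x - y) = Cmod (y - x).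
Proof. rewrite <- Cmod_opp; f_equal; ring. Qed.

(** * Complex differentiability and continuity in epsilon-delta form *)

Lemma cderiv_at_iff (f : C -> C) (z l : C) :
  cderiv_at f z l <->
  forall eps, 0 < eps -> exists d, 0 < d /\ forall y, Cmod (y - z) < d ->
    Cmod (f y - f z - l * (y - z)) <= eps * Cmod (y - z).
Proof.
  unfold cderiv_at, is_derive, filterdiff; split.
  - intros [_ H] eps Heps.
    specialize (H z (fun P HP => HP) (mkposreal eps Heps)).
    assert (H' := locally_le_locally_norm (V := AbsRing_NormedModule C_AbsRing) z _ H).
    destruct H' as [d Hd].
    exists d; split; [apply cond_pos|].
    intros y Hy. specialize (Hd y Hy).
    simpl in Hd.
    replace (l * (y - z))%C with ((y - z) * l)%C by ring. exact Hd.
  - intros H; split; [apply (is_linear_scal_l (V := C_NormedModule) l)|].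
    intros x Hx. apply (is_filter_lim_locally_unique (V := AbsRing_NormedModule C_AbsRing)) in Hx.
    subst x. intros eps.
    apply (locally_norm_le_locally (V := AbsRing_NormedModule C_AbsRing) z).
    destruct (H eps (cond_pos eps)) as [d [Hd Hd']].
    exists (mkposreal d Hd). intros y Hy.
    specialize (Hd' y Hy).
    replace (l * (y - z))%C with ((y - z) * l)%C in Hd' by ring. exact Hd'.
Qed.

Lemma is_derive_R_iff (f : R -> R) (x l : R) :
  is_derive f x l <->
  forall eps, 0 < eps -> exists d, 0 < d /\ forall y, Rabs (y - x) < d ->
    Rabs (f y - f x - l * (y - x)) <= eps * Rabs (y - x).
Proof.
  unfold is_derive, filterdiff; split.
  - intros [_ H] eps Heps.
    specialize (H x (fun P HP => HP) (mkposreal eps Heps)).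
    destruct H as [d Hd].
    exists d; split; [apply cond_pos|].
    intros y Hy. specialize (Hd y Hy).
    replace (l * (y - x)) with ((y - x) * l) by ring. exact Hd.
  - intros H; split; [apply is_linear_scal_l|].
    intros z Hz. apply (is_filter_lim_locally_unique (V := R_NormedModule)) in Hz.
    subst z. intros eps.
    destruct (H eps (cond_pos eps)) as [d [Hd Hd']].
    exists (mkposreal d Hd). intros y Hy.
    specialize (Hd' y Hy).
    replace (l * (y - x)) with ((y - x) * l) in Hd' by ring. exact Hd'.
Qed.

Lemma cderiv_at_unique (f : C -> C) (z l1 l2 : C) :
  cderiv_at f z l1 -> cderiv_at f z l2 -> l1 = l2.
Proof.
  intros H1 H2. rewrite <- (is_C_derive_unique f z l1 H1). apply is_C_derive_unique, H2.
Qed.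

Lemma Cderiv_eq (f : C -> C) (z l : C) : cderiv_at f z l -> Cderiv f z = l.
Proof.
  intros H. apply (cderiv_at_unique f z); [|exact H].
  apply (epsilon_spec (inhabits (0%R, 0%R)) (fun l => cderiv_at f z l)).
  exists l; exact H.
Qed.

Lemma Cderiv_correct (f : C -> C) (z : C) :
  analytic_disk f -> in_disk z -> cderiv_at f z (Cderiv f z).
Proof. intros H Hz. destruct (H z Hz) as [l Hl]. rewrite (Cderiv_eq f z l Hl). exact Hl. Qed.

(** The two parts are kept separate so that either one can be handed directly to results on real
    integrands. The source is a general uniform space because both [R] and [R * R] occur. *)
Definition Ccont {U : UniformSpace} (g : U -> C) (x : U) : Prop :=
  continuous (fun y => Re (g y)) x /\ continuous (fun y => Im (g y)) x.

Lemma Ccont_iff {U : UniformSpace} (g : U -> C) (x : U) :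
  Ccont g x <-> forall eps, 0 < eps -> locally x (fun y => Cmod (g y - g x) < eps).
Proof.
  split.
  - intros [H1 H2] eps Heps.
    assert (He : 0 < eps / 2) by lra.
    assert (A : locally x (fun y => Rabs (Re (g y) - Re (g x)) < eps / 2))
      by exact (H1 (ball (Re (g x)) (eps / 2)) (locally_ball _ (mkposreal _ He))).
    assert (B : locally x (fun y => Rabs (Im (g y) - Im (g x)) < eps / 2))
      by exact (H2 (ball (Im (g x)) (eps / 2)) (locally_ball _ (mkposreal _ He))).
    generalize (filter_and _ _ A B).
    apply filter_imp. clear A B. intros y [A B]. eapply Rle_lt_trans; [apply Cmod_le_Re_Im|].
    rewrite re_minus, im_minus. lra.
  - intros H; split; intros P [eps HP];
    [change (locally x (fun y => P (Re (g y)))) | change (locally x (fun y => P (Im (g y))))];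
    generalize (H eps (cond_pos eps)); apply filter_imp; intros y Hy; apply HP;
    (eapply Rle_lt_trans; [|exact Hy]).
    + eapply Rle_trans; [|apply re_le_Cmod]. rewrite re_minus. apply Rle_refl.
    + eapply Rle_trans; [|apply im_le_Cmod]. rewrite im_minus. apply Rle_refl.
Qed.

Lemma Ccont_const {U : UniformSpace} (c : C) (x : U) : Ccont (fun _ => c) x.
Proof. split; apply continuous_const. Qed.

Lemma Ccont_RtoC {U : UniformSpace} (u : U -> R) (x : U) :
  continuous u x -> Ccont (fun y => RtoC (u y)) x.
Proof. intros H; split; [exact H|apply continuous_const]. Qed.

Lemma Ccont_plus {U : UniformSpace} (f g : U -> C) (x : U) :
  Ccont f x -> Ccont g x -> Ccont (fun y => f y + g y)%C x.
Proof.
  intros [A B] [A' B']; split.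
  - apply (continuous_plus (V := R_NormedModule)) with (1 := A) (2 := A').
  - apply (continuous_plus (V := R_NormedModule)) with (1 := B) (2 := B').
Qed.

Lemma Ccont_mult {U : UniformSpace} (f g : U -> C) (x : U) :
  Ccont f x -> Ccont g x -> Ccont (fun y => f y * g y)%C x.
Proof.
  intros [A B] [A' B']; split.
  - apply (continuous_minus (V := R_NormedModule)).
    + apply (continuous_mult (K := R_AbsRing)) with (1 := A) (2 := A').
    + apply (continuous_mult (K := R_AbsRing)) with (1 := B) (2 := B').
  - apply (continuous_plus (V := R_NormedModule)).
    + apply (continuous_mult (K := R_AbsRing)) with (1 := A) (2 := B').
    + apply (continuous_mult (K := R_AbsRing)) with (1 := B) (2 := A').
Qed.

Lemma Ccont_minus {U : UniformSpace} (f g : U -> C) (x : U) :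
  Ccont f x -> Ccont g x -> Ccont (fun y => f y - g y)%C x.
Proof.
  intros [A B] [A' B']; split.
  - apply (continuous_minus (V := R_NormedModule)) with (1 := A) (2 := A').
  - apply (continuous_minus (V := R_NormedModule)) with (1 := B) (2 := B').
Qed.

Lemma Ccont_pow {U : UniformSpace} (f : U -> C) (n : nat) (x : U) :
  Ccont f x -> Ccont (fun y => Cpow (f y) n) x.
Proof.
  intros H; induction n as [|n IH]; simpl; [apply Ccont_const|apply Ccont_mult; assumption].
Qed.

Lemma Ccont_comp {U : UniformSpace} (f : C -> C) (g : U -> C) (x : U) (l : C) :
  cderiv_at f (g x) l -> Ccont g x -> Ccont (fun y => f (g y)) x.
Proof.
  rewrite cderiv_at_iff, !Ccont_iff. intros Hf Hg eps Heps.
  (* With tolerance 1 in the derivative, [f] grows near [g x] by at most the factor [1 + Cmod l]. *)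
  destruct (Hf 1 Rlt_0_1) as [d [Hd Hd']].
  assert (HL : 0 < 1 + Cmod l) by (generalize (Cmod_ge_0 l); lra).
  assert (Hm : 0 < Rmin d (eps / (1 + Cmod l))).
  { apply Rmin_pos; [assumption|apply Rdiv_lt_0_compat; assumption]. }
  generalize (Hg _ Hm). apply filter_imp. intros y Hy.
  assert (H1 := Rlt_le_trans _ _ _ Hy (Rmin_l _ _)).
  assert (H2 := Rlt_le_trans _ _ _ Hy (Rmin_r _ _)).
  specialize (Hd' _ H1).
  replace (f (g y) - f (g x))%C
    with (f (g y) - f (g x) - l * (g y - g x) + l * (g y - g x))%C by ring.
  eapply Rle_lt_trans; [apply Cmod_triangle|]. rewrite Cmod_mult.
  apply Rle_lt_trans with ((1 + Cmod l) * Cmod (g y - g x)); [lra|].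
  apply Rmult_lt_compat_l with (r := 1 + Cmod l) in H2; [|assumption].
  replace ((1 + Cmod l) * (eps / (1 + Cmod l))) with eps in H2 by (field; lra). exact H2.
Qed.

Lemma Ccont_inv {U : UniformSpace} (f : U -> C) (x : U) :
  f x <> 0 -> Ccont f x -> Ccont (fun y => / f y)%C x.
Proof.
  intros H0 [A B].
  assert (HN : continuous (fun y => Re (f y) ^ 2 + Im (f y) ^ 2) x).
  { apply (continuous_plus (V := R_NormedModule)); simpl;
    apply (continuous_mult (K := R_AbsRing)); try assumption;
    apply (continuous_mult (K := R_AbsRing)); try assumption; apply continuous_const. }
  assert (HI : continuous (fun y => / (Re (f y) ^ 2 + Im (f y) ^ 2)) x).
  { apply (continuous_comp _ Rinv); [exact HN|].
    apply continuity_pt_filterlim. apply continuity_pt_inv.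
    - apply derivable_continuous_pt, derivable_pt_id.
    - unfold id. intros E. apply H0. apply Cmod_eq_0. unfold Cmod.
      unfold Re, Im in E. rewrite E. apply sqrt_0. }
  split.
  - apply (continuous_mult (K := R_AbsRing)) with (1 := A) (2 := HI).
  - apply (continuous_mult (K := R_AbsRing)); [|exact HI].
    apply (continuous_opp (V := R_NormedModule)) with (1 := B).
Qed.

Lemma continuous_Cmod {U : UniformSpace} (f : U -> C) (x : U) :
  Ccont f x -> continuous (fun y => Cmod (f y)) x.
Proof.
  rewrite Ccont_iff. intros H P [eps HP]. change (locally x (fun y => P (Cmod (f y)))).
  generalize (H eps (cond_pos eps)); apply filter_imp; intros y Hy; apply HP.
  apply Rle_lt_trans with (2 := Hy).
  change (Rabs (Cmod (f y) - Cmod (f x)) <= Cmod (f y - f x)).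
  assert (E1 := Cmod_triangle (f y - f x) (f x)).
  assert (E2 := Cmod_triangle (f x - f y) (f y)).
  replace (f y - f x + f x)%C with (f y) in E1 by ring.
  replace (f x - f y + f y)%C with (f x) in E2 by ring.
  rewrite (Cmod_minus_sym (f x)) in E2. apply Rabs_le; lra.
Qed.

(** Chain rule for a holomorphic function along a differentiable curve in the plane; the free factor
    [k] makes one real statement cover both the real and the imaginary part. *)
Lemma is_derive_Re_comp (f : C -> C) (g : R -> C) (t : R) (l g' k : C) :
  cderiv_at f (g t) l ->
  is_derive (fun s => Re (g s)) t (Re g') -> is_derive (fun s => Im (g s)) t (Im g') ->
  is_derive (fun s => Re (k * f (g s))) t (Re (k * (l * g'))).
Proof.
  rewrite cderiv_at_iff, !is_derive_R_iff. intros Hf H1 H2 eps Heps.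
  assert (Hk := Cmod_ge_0 k). assert (Hl := Cmod_ge_0 l). assert (Hg := Cmod_ge_0 g').
  set (D := (Cmod k + 1) * (Cmod l + 1)).
  assert (HD : 0 < D) by (unfold D; nra).
  (* Each of two errors gets eps/2: the error of the curve, multiplied by |l|, is controlled by
     [e1], and that of [f] by [e2]. Since [e1 <= 1], [L] is a local Lipschitz constant of the
     curve. *)
  set (e1 := Rmin 1 (eps / (4 * D))).
  assert (He1 : 0 < e1).
  { apply Rmin_pos; [lra|apply Rdiv_lt_0_compat; lra]. }
  assert (He1' : 4 * D * e1 <= eps).
  { replace eps with (4 * D * (eps / (4 * D))) at 1 by (field; lra).
    apply Rmult_le_compat_l; [lra|apply Rmin_r]. }
  assert (He11 : e1 <= 1) by apply Rmin_l.
  set (L := Cmod g' + 2).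
  assert (HL : 0 < L) by (unfold L; lra).
  set (e2 := eps / (2 * (Cmod k + 1) * L)).
  assert (He2 : 0 < e2) by (apply Rdiv_lt_0_compat; [lra|nra]).
  assert (He2' : 2 * (Cmod k + 1) * L * e2 = eps) by (unfold e2; field; lra).
  destruct (Hf e2 He2) as [d0 [Hd0 Hf']].
  destruct (H1 e1 He1) as [d1 [Hd1 H1']]. destruct (H2 e1 He1) as [d2 [Hd2 H2']].
  exists (Rmin (Rmin d1 d2) (d0 / L)); split.
  { repeat apply Rmin_pos; try assumption. apply Rdiv_lt_0_compat; assumption. }
  intros y Hy.
  assert (Y1 : Rabs (y - t) < d1).
  { eapply Rlt_le_trans; [exact Hy|]. eapply Rle_trans; apply Rmin_l. }
  assert (Y2 : Rabs (y - t) < d2).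
  { eapply Rlt_le_trans; [exact Hy|]. eapply Rle_trans; [apply Rmin_l|apply Rmin_r]. }
  assert (Y3 : L * Rabs (y - t) < d0).
  { assert (Y3 : Rabs (y - t) < d0 / L) by (eapply Rlt_le_trans; [exact Hy|apply Rmin_r]).
    apply Rmult_lt_compat_l with (r := L) in Y3; [|assumption].
    replace (L * (d0 / L)) with d0 in Y3 by (field; lra). exact Y3. }
  specialize (H1' y Y1). specialize (H2' y Y2).
  assert (Hy0 := Rabs_pos (y - t)).
  assert (G : Cmod (g y - g t - g' * RtoC (y - t)) <= 2 * e1 * Rabs (y - t)).
  { eapply Rle_trans; [apply Cmod_le_Re_Im|].
    rewrite !re_minus, !im_minus, re_scal_r, im_scal_r. lra. }
  assert (G2 : Cmod (g y - g t) <= L * Rabs (y - t)).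
  { replace (g y - g t)%C with (g y - g t - g' * RtoC (y - t) + g' * RtoC (y - t))%C by ring.
    eapply Rle_trans; [apply Cmod_triangle|]. rewrite Cmod_mult, Cmod_R. unfold L. nra. }
  assert (F := Hf' (g y) (Rle_lt_trans _ _ _ G2 Y3)).
  replace (Re (k * f (g y)) - Re (k * f (g t)) - Re (k * (l * g')) * (y - t))
    with (Re (k * (f (g y) - f (g t) - l * (g y - g t)
              + l * (g y - g t - g' * RtoC (y - t))))).
  2: { unfold Re, Cminus, Cmult, Cplus, Copp, RtoC; simpl. ring. }
  eapply Rle_trans; [apply re_le_Cmod|]. rewrite Cmod_mult.
  assert (T : Cmod (f (g y) - f (g t) - l * (g y - g t) + l * (g y - g t - g' * RtoC (y - t)))
    <= e2 * (L * Rabs (y - t)) + Cmod l * (2 * e1 * Rabs (y - t))).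
  { eapply Rle_trans; [apply Cmod_triangle|]. rewrite Cmod_mult.
    apply Rplus_le_compat.
    - eapply Rle_trans; [exact F|]. apply Rmult_le_compat_l; [lra|exact G2].
    - apply Rmult_le_compat_l; assumption. }
  apply Rle_trans with ((Cmod k + 1) * (e2 * (L * Rabs (y - t)) + Cmod l * (2 * e1 * Rabs (y - t)))).
  { apply Rmult_le_compat; try lra. apply Cmod_ge_0. }
  replace (eps * Rabs (y - t)) with (eps / 2 * Rabs (y - t) + eps / 2 * Rabs (y - t)) by field.
  rewrite Rmult_plus_distr_l. apply Rplus_le_compat.
  - rewrite <- He2'. apply Req_le. field.
  - apply Rle_trans with (2 * D * e1 * Rabs (y - t)); [|nra].
    unfold D. assert (0 <= e1 * Rabs (y - t)) by nra.
    replace ((Cmod k + 1) * (Cmod l * (2 * e1 * Rabs (y - t))))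
      with (2 * (Cmod k + 1) * Cmod l * (e1 * Rabs (y - t))) by ring.
    replace (2 * ((Cmod k + 1) * (Cmod l + 1)) * e1 * Rabs (y - t))
      with (2 * (Cmod k + 1) * (Cmod l + 1) * (e1 * Rabs (y - t))) by ring.
    apply Rmult_le_compat_r; nra.
Qed.

(** * Power series on disks *)

(** Nothing is said about [f] outside the disk of radius [r], in accordance with the identification
    of functions that agree on the disk. The radius is a parameter because expansions are first
    obtained on smaller disks. *)
Definition has_ps (r : R) (f : C -> C) (c : nat -> C) : Prop :=
  forall z, Cmod z < r ->
    is_series (V := C_NormedModule) (fun n => c n * Cpow z n)%C (f z).

Lemma is_series_C_iff (a : nat -> C) (l : C) :
  is_series (V := C_NormedModule) a l <->
  is_lim_seq (fun n => Cmod (sum_n (G := C_NormedModule) a n - l)) 0.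
Proof.
  split.
  - intros H. apply is_lim_seq_spec. intros eps.
    assert (H' : filterlim (sum_n (G := C_NormedModule) a) eventually (locally_norm (V := C_NormedModule) l)).
    { apply filterlim_filter_le_2 with (2 := H). apply (locally_le_locally_norm (V := C_NormedModule)). }
    specialize (H' (ball_norm (V := C_NormedModule) l eps)).
    assert (N : locally_norm (V := C_NormedModule) l (ball_norm (V := C_NormedModule) l eps))
      by (exists eps; auto).
    destruct (H' N) as [n0 Hn0]. exists n0. intros n Hn. rewrite Rminus_0_r, Rabs_pos_eq by apply Cmod_ge_0.
    apply (Hn0 n Hn).
  - intros H. apply is_lim_seq_spec in H.
    eapply filterlim_filter_le_2; [apply (locally_norm_le_locally (V := C_NormedModule))|].
    intros P [eps HP]. destruct (H eps) as [n0 Hn0]. exists n0. intros n Hn.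
    apply HP. specialize (Hn0 n Hn). rewrite Rminus_0_r, Rabs_pos_eq in Hn0 by apply Cmod_ge_0. exact Hn0.
Qed.

Lemma Cmod_sum_n_le (a : nat -> C) (b : nat -> R) (n : nat) :
  (forall k, Cmod (a k) <= b k) ->
  Cmod (sum_n (G := C_NormedModule) a n) <= sum_n b n.
Proof.
  intros H. induction n as [|n IH].
  - rewrite !sum_O. apply H.
  - rewrite !sum_Sn. eapply Rle_trans; [apply Cmod_triangle|].
    apply Rplus_le_compat; [exact IH|apply H].
Qed.

Lemma Cmod_is_series_le (a : nat -> C) (b : nat -> R) (l : C) (s : R) :
  is_series (V := C_NormedModule) a l -> is_series b s ->
  (forall n, Cmod (a n) <= b n) -> Cmod l <= s.
Proof.
  intros Ha Hb H. rewrite is_series_C_iff in Ha.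
  apply (is_lim_seq_le (fun _ => Cmod l) (fun n => Cmod (sum_n (G := C_NormedModule) a n - l) + sum_n b n)
    (Cmod l) s).
  - intros n. assert (E := Cmod_sum_n_le a b n H).
    replace l with (- (sum_n (G := C_NormedModule) a n - l) + sum_n (G := C_NormedModule) a n)%C at 1 by ring.
    eapply Rle_trans; [apply Cmod_triangle|]. rewrite Cmod_opp. lra.
  - apply is_lim_seq_const.
  - replace (Finite s) with (Finite (0 + s)) by (f_equal; ring).
    apply is_lim_seq_plus'; [exact Ha|exact Hb].
Qed.

Lemma is_series_C_unique (a : nat -> C) (l1 l2 : C) :
  is_series (V := C_NormedModule) a l1 -> is_series (V := C_NormedModule) a l2 -> l1 = l2.
Proof. intros H1 H2. exact (filterlim_locally_unique _ _ _ H1 H2). Qed.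

Lemma ex_series_C_le (a : nat -> C) (b : nat -> R) :
  (forall n, Cmod (a n) <= b n) -> ex_series b ->
  exists l : C, is_series (V := C_NormedModule) a l.
Proof. intros H Hb. exact (ex_series_le (V := C_CompleteNormedModule) a b H Hb). Qed.

(** This is the second derivative of the geometric series, and differentiation preserves the radius
    of convergence. The quadratic factor pays for second-order remainders of powers and for the
    product of m with the linear factor of the shift. *)
Lemma ex_series_quadratic_geom (q : R) :
  0 <= q < 1 -> ex_series (fun n => (INR n + 1) * (INR n + 2) * q ^ n).
Proof.
  intros Hq.
  assert (E : ex_pseries (PS_derive (PS_derive (fun _ => 1))) q).
  { apply ex_pseries_derive. rewrite CV_radius_derive, Rabs_pos_eq by lra.
    apply Rbar_lt_le_trans with ((1 + q) / 2); [simpl; lra|].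
    apply (proj1 (CV_radius_bounded (fun _ => 1))). exists 1. intros n.
    rewrite Rmult_1_l, <- RPow_abs, (Rabs_pos_eq ((1 + q) / 2)) by lra.
    apply Rle_trans with (1 ^ n); [apply pow_incr; lra|rewrite pow1; lra]. }
  apply ex_series_ext with (2 := E). intros n.
  rewrite pow_n_pow. unfold PS_derive.
  change (q ^ n * (INR (S n) * (INR (S (S n)) * 1)) = (INR n + 1) * (INR n + 2) * q ^ n).
  rewrite !S_INR. ring.
Qed.

(** At the real point z = s the partial sums converge, hence are bounded by some M; each later term
    is a difference of two consecutive partial sums, so 2 M bounds it. The added 1 makes the bound
    positive. *)
Lemma has_ps_bounded (r s : R) (f : C -> C) (c : nat -> C) :
  has_ps r f c -> 0 <= s < r -> exists B, 0 < B /\ forall n, Cmod (c n) * s ^ n <= B.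
Proof.
  intros H Hs. assert (Hz : Cmod (RtoC s) < r) by (rewrite Cmod_R, Rabs_pos_eq; lra).
  specialize (H _ Hz).
  destruct (filterlim_bounded (V := C_NormedModule) _ (ex_intro _ _ H)) as [M HM].
  set (a := (fun n => c n * Cpow (RtoC s) n)%C) in *.
  change (forall n, Cmod (sum_n (G := C_NormedModule) a n) <= M) in HM.
  assert (HM0 : 0 <= M) by (apply Rle_trans with (2 := HM O), Cmod_ge_0).
  exists (2 * M + 1). split; [lra|]. intros n.
  replace (Cmod (c n) * s ^ n) with (Cmod (a n)).
  2: { unfold a. rewrite Cmod_mult, Cmod_pow, Cmod_R, Rabs_pos_eq by lra. reflexivity. }
  destruct n as [|n].
  - specialize (HM O). rewrite sum_O in HM. lra.
  - assert (H1 := HM n). assert (H2 := HM (S n)).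
    replace (a (S n)) with (sum_n (G := C_NormedModule) a (S n) + - sum_n (G := C_NormedModule) a n)%C.
    + eapply Rle_trans; [apply Cmod_triangle|]. rewrite Cmod_opp. lra.
    + rewrite sum_Sn.
      change (sum_n (G := C_NormedModule) a n + a (S n) + - sum_n (G := C_NormedModule) a n = a (S n))%C. ring.
Qed.

Lemma has_ps_ext (r : R) (f g : C -> C) (c : nat -> C) :
  (forall z, Cmod z < r -> f z = g z) -> has_ps r f c -> has_ps r g c.
Proof. intros E H z Hz. rewrite <- E by exact Hz. apply H, Hz. Qed.

Lemma has_ps_coef_ext (r : R) (f : C -> C) (c d : nat -> C) :
  (forall n, c n = d n) -> has_ps r f c -> has_ps r f d.
Proof.
  intros E H z Hz. apply is_series_ext with (2 := H z Hz). intros n. rewrite E. reflexivity.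
Qed.

Lemma has_ps_plus (r : R) (f g : C -> C) (c d : nat -> C) :
  has_ps r f c -> has_ps r g d -> has_ps r (fun z => f z + g z)%C (fun n => c n + d n)%C.
Proof.
  intros Hf Hg z Hz. apply is_series_ext with (2 := is_series_plus _ _ _ _ (Hf z Hz) (Hg z Hz)).
  intros n. change (c n * z ^ n + d n * z ^ n = (c n + d n) * z ^ n)%C. ring.
Qed.

Lemma has_ps_scal (r : R) (f : C -> C) (c : nat -> C) (k : C) :
  has_ps r f c -> has_ps r (fun z => k * f z)%C (fun n => k * c n)%C.
Proof.
  intros Hf z Hz. apply is_series_ext with (2 := is_series_scal k _ _ (Hf z Hz)).
  intros n. change (k * (c n * z ^ n) = k * c n * z ^ n)%C. ring.
Qed.

Lemma has_ps_minus (r : R) (f g : C -> C) (c d : nat -> C) :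
  has_ps r f c -> has_ps r g d -> has_ps r (fun z => f z - g z)%C (fun n => c n - d n)%C.
Proof.
  intros Hf Hg. assert (H := has_ps_plus _ _ _ _ _ Hf (has_ps_scal _ _ _ (-1)%C Hg)).
  apply has_ps_ext with (f := fun z => (f z + -1 * g z)%C); [intros; ring|].
  apply has_ps_coef_ext with (2 := H). intros; ring.
Qed.

Lemma has_ps_at_0 (r : R) (f : C -> C) (c : nat -> C) :
  0 < r -> has_ps r f c -> f (RtoC 0) = c O.
Proof.
  intros Hr H. assert (H0 : Cmod (RtoC 0) < r) by (rewrite Cmod_0; exact Hr).
  apply (is_series_C_unique _ _ _ (H _ H0)). apply is_series_C_iff.
  apply is_lim_seq_ext with (fun _ => 0); [|apply is_lim_seq_const].
  intros n. replace (sum_n (G := C_NormedModule) (fun n0 => (c n0 * RtoC 0 ^ n0)%C) n) with (c O).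
  { replace (c O - c O)%C with (RtoC 0) by ring. rewrite Cmod_0. reflexivity. }
  induction n as [|n IH].
  - rewrite sum_O. simpl. ring.
  - rewrite sum_Sn, <- IH. change (c O = c O + c (S n) * (0 * RtoC 0 ^ n))%C. ring.
Qed.

Lemma has_ps_exists (r : R) (c : nat -> C) :
  (forall s, 0 <= s < r -> exists B, forall n, Cmod (c n) * s ^ n <= B) ->
  exists f, has_ps r f c.
Proof.
  intros H.
  exists (fun z => epsilon (inhabits (RtoC 0))
    (fun l => is_series (V := C_NormedModule) (fun n => c n * Cpow z n)%C l)).
  intros z Hz. apply epsilon_spec. assert (Hz0 := Cmod_ge_0 z).
  set (s := (Cmod z + r) / 2).
  destruct (H s) as [B HB]; [unfold s; lra|].
  assert (Hs : 0 < s) by (unfold s; lra).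
  apply ex_series_C_le with (fun n => B * (Cmod z / s) ^ n).
  - intros n. rewrite Cmod_mult, Cmod_pow.
    replace (Cmod z ^ n) with (s ^ n * (Cmod z / s) ^ n).
    2: { rewrite <- Rpow_mult_distr. f_equal. field. lra. }
    rewrite <- Rmult_assoc. apply Rmult_le_compat_r; [|apply HB].
    apply pow_le. apply Rdiv_le_0_compat; lra.
  - apply (ex_series_scal (V := R_NormedModule) B). apply ex_series_geom.
    rewrite Rabs_pos_eq by (apply Rdiv_le_0_compat; lra).
    apply Rlt_div_l; [lra|unfold s; lra].
Qed.

(** If D_n is the remainder, then D_(n+1) = (z + h) D_n + n z^(n-1) h^2, and n^2 + n <= (n+1)^2
    closes the induction. The factor s^2 on the left avoids the exponent n - 2. *)
Lemma Cpow_second_order (z h : C) (s : R) (n : nat) :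
  Cmod z <= s -> Cmod (z + h) <= s ->
  s ^ 2 * Cmod (Cpow (z + h) n - Cpow z n - RtoC (INR n) * Cpow z (pred n) * h)
    <= INR n ^ 2 * Cmod h ^ 2 * s ^ n.
Proof.
  intros Hz Hzh. assert (Hh := Cmod_ge_0 h). assert (Hz0 := Cmod_ge_0 z).
  induction n as [|n IH].
  - simpl. replace (1 - 1 - 0 * 1 * h)%C with (RtoC 0) by ring. rewrite Cmod_0. lra.
  - set (D := (Cpow (z + h) n - Cpow z n - RtoC (INR n) * Cpow z (pred n) * h)%C) in *.
    assert (E : (Cpow (z + h) (S n) - Cpow z (S n) - RtoC (INR (S n)) * Cpow z (pred (S n)) * h
      = (z + h) * D + RtoC (INR n) * Cpow z (pred n) * h ^ 2)%C).
    { unfold D. rewrite S_INR, RtoC_plus. simpl pred. rewrite !Cpow_S.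
      destruct n as [|n]; [simpl; ring|]. simpl pred. rewrite !Cpow_S. ring. }
    rewrite E.
    assert (P : s ^ 2 * (INR n * Cmod z ^ pred n * Cmod h ^ 2) <= INR n * Cmod h ^ 2 * s ^ S n).
    { destruct n as [|n]; [simpl; lra|]. simpl pred.
      assert (Q : Cmod z ^ n <= s ^ n) by (apply pow_incr; lra).
      assert (0 <= INR (S n) * Cmod h ^ 2 * s ^ 2).
      { apply Rmult_le_pos; [apply Rmult_le_pos; [apply pos_INR|nra]|nra]. }
      replace (INR (S n) * Cmod h ^ 2 * s ^ S (S n)) with (INR (S n) * Cmod h ^ 2 * s ^ 2 * s ^ n)
        by (simpl; ring).
      replace (s ^ 2 * (INR (S n) * Cmod z ^ n * Cmod h ^ 2))
        with (INR (S n) * Cmod h ^ 2 * s ^ 2 * Cmod z ^ n) by ring.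
      apply Rmult_le_compat_l; assumption. }
    apply Rle_trans with (s * (s ^ 2 * Cmod D) + s ^ 2 * (INR n * Cmod z ^ pred n * Cmod h ^ 2)).
    + replace (s * (s ^ 2 * Cmod D) + s ^ 2 * (INR n * Cmod z ^ pred n * Cmod h ^ 2))
        with (s ^ 2 * (s * Cmod D + INR n * Cmod z ^ pred n * Cmod h ^ 2)) by ring.
      apply Rmult_le_compat_l; [nra|]. eapply Rle_trans; [apply Cmod_triangle|].
      rewrite !Cmod_mult, !Cmod_pow, Cmod_R, (Rabs_pos_eq (INR n)) by apply pos_INR.
      apply Rplus_le_compat_r. apply Rmult_le_compat_r; [apply Cmod_ge_0|exact Hzh].
    + apply Rle_trans with (s * (INR n ^ 2 * Cmod h ^ 2 * s ^ n) + INR n * Cmod h ^ 2 * s ^ S n).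
      * apply Rplus_le_compat; [|exact P]. apply Rmult_le_compat_l; [lra|exact IH].
      * rewrite S_INR. assert (0 <= Cmod h ^ 2 * s ^ S n) by (apply Rmult_le_pos; [nra|apply pow_le; lra]).
        assert (Hn := pos_INR n). simpl in *. nra.
Qed.

Definition dcoef (c : nat -> C) (n : nat) : C := (RtoC (INR (S n)) * c (S n))%C.

(** The remainder of [f] is the sum of [c n] times the second-order remainders of the powers. As
    |c_n| s^n decays geometrically, it is at most a constant times |h|^2. *)
Lemma has_ps_termwise_derivative (r : R) (f : C -> C) (c : nat -> C) (z : C) :
  has_ps r f c -> Cmod z < r ->
  exists l : C, is_series (V := C_NormedModule) (fun n => dcoef c n * Cpow z n)%C l
    /\ cderiv_at f z l.
Proof.
  intros Hf Hz. assert (Hz0 := Cmod_ge_0 z).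
  (* [s] bounds z and z + h, while the coefficient bound is taken at the larger [s']; the ratio of
     the two radii leaves geometric decay at [s]. *)
  set (s := (2 * Cmod z + r) / 3). set (s' := (Cmod z + 2 * r) / 3).
  assert (Hs : 0 < s /\ Cmod z < s < s' /\ s' < r) by (unfold s, s'; lra).
  destruct (has_ps_bounded r s' f c Hf) as [B [HB0 HB]]; [lra|].
  set (q := s / s').
  assert (Hq : 0 <= q < 1).
  { unfold q; split; [apply Rdiv_le_0_compat; lra|apply Rlt_div_l; lra]. }
  assert (Hcs : forall n, Cmod (c n) * s ^ n <= B * q ^ n).
  { intros n. replace (s ^ n) with (s' ^ n * q ^ n).
    2: { unfold q. rewrite <- Rpow_mult_distr. f_equal. field. lra. }
    rewrite <- Rmult_assoc. apply Rmult_le_compat_r; [apply pow_le; lra|apply HB]. }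
  destruct (ex_series_quadratic_geom q Hq) as [Q HQ].
  assert (HL : exists l : C, is_series (V := C_NormedModule) (fun n => dcoef c n * Cpow z n)%C l).
  { apply ex_series_C_le with (fun n => (B / s) * ((INR n + 1) * (INR n + 2) * q ^ n)).
    2: { apply (ex_series_scal (V := R_NormedModule) (B / s)). exists Q; exact HQ. }
    intros n. unfold dcoef. rewrite !Cmod_mult, Cmod_pow, Cmod_R, Rabs_pos_eq by apply pos_INR.
    apply Rmult_le_reg_r with s; [lra|].
    replace (B / s * ((INR n + 1) * (INR n + 2) * q ^ n) * s) with (B * ((INR n + 1) * (INR n + 2) * q ^ n))
      by (field; lra).
    apply Rle_trans with (INR (S n) * (Cmod (c (S n)) * s ^ S n)).
    { replace (INR (S n) * Cmod (c (S n)) * Cmod z ^ n * s)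
        with (INR (S n) * Cmod (c (S n)) * s * Cmod z ^ n) by ring.
      replace (INR (S n) * (Cmod (c (S n)) * s ^ S n))
        with (INR (S n) * Cmod (c (S n)) * s * s ^ n) by (simpl; ring).
      apply Rmult_le_compat_l.
      - apply Rmult_le_pos; [|lra]. apply Rmult_le_pos; [apply pos_INR|apply Cmod_ge_0].
      - apply pow_incr; lra. }
    apply Rle_trans with (INR (S n) * (B * q ^ S n)).
    { apply Rmult_le_compat_l; [apply pos_INR|apply Hcs]. }
    rewrite S_INR. assert (Hn := pos_INR n).
    assert (0 <= q ^ n) by (apply pow_le; lra).
    replace ((INR n + 1) * (B * q ^ S n)) with (B * q ^ n * (INR n + 1) * q) by (simpl; ring).
    replace (B * ((INR n + 1) * (INR n + 2) * q ^ n)) with (B * q ^ n * (INR n + 1) * (INR n + 2)) by ring.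
    apply Rmult_le_compat_l; [|lra]. apply Rmult_le_pos; [|lra]. apply Rmult_le_pos; lra. }
  destruct HL as [l Hl]. exists l; split; [exact Hl|].
  apply cderiv_at_iff. intros eps Heps.
  assert (HQ0 : 0 <= Q).
  { apply Rle_trans with (Cmod 0); [apply Cmod_ge_0|].
    apply (Cmod_is_series_le (fun _ => RtoC 0) _ 0 Q) with (2 := HQ).
    - apply is_series_C_iff. apply is_lim_seq_ext with (fun _ => 0); [|apply is_lim_seq_const].
      intros n. replace (sum_n (G := C_NormedModule) (fun _ => RtoC 0) n) with (RtoC 0).
      + replace (RtoC 0 - 0)%C with (RtoC 0) by ring. rewrite Cmod_0; reflexivity.
      + induction n as [|n IH]; [rewrite sum_O; reflexivity|].
        rewrite sum_Sn, <- IH. change (RtoC 0 = 0 + 0)%C. ring.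
    - intros n. rewrite Cmod_0. assert (Hn := pos_INR n).
      apply Rmult_le_pos; [nra|apply pow_le; lra]. }
  set (K := B * Q / s ^ 2).
  assert (HK : 0 <= K) by (unfold K; apply Rdiv_le_0_compat; [nra|nra]).
  exists (Rmin (s - Cmod z) (eps / (K + 1))); split.
  { apply Rmin_pos; [lra|apply Rdiv_lt_0_compat; lra]. }
  intros y Hy. set (h := (y - z)%C) in *. assert (Hh := Cmod_ge_0 h).
  assert (Hh1 : Cmod h < s - Cmod z) by (eapply Rlt_le_trans; [exact Hy|apply Rmin_l]).
  assert (Hh2 : (K + 1) * Cmod h <= eps).
  { apply Rlt_le. replace eps with ((K + 1) * (eps / (K + 1))) by (field; lra).
    apply Rmult_lt_compat_l; [lra|]. eapply Rlt_le_trans; [exact Hy|apply Rmin_r]. }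
  replace y with (z + h)%C by (unfold h; ring).
  assert (Hzh : Cmod (z + h) <= s) by (eapply Rle_trans; [apply Cmod_triangle|lra]).
  (* The derivative series is reindexed to start one step earlier, in the form in which it is
     subtracted from the powers; the new term at 0 vanishes because of the factor [INR 0]. *)
  assert (Hd : is_series (V := C_NormedModule)
    (fun n => c n * RtoC (INR n) * Cpow z (pred n))%C l).
  { apply (is_series_decr_1 (V := C_NormedModule)).
    match goal with |- is_series _ ?x => replace x with l end.
    2: { change (l = l + - (c O * 0 * 1))%C. ring. }
    apply is_series_ext with (2 := Hl). intros n. unfold dcoef. simpl pred.
    change (RtoC (INR (S n)) * c (S n) * z ^ n = c (S n) * RtoC (INR (S n)) * z ^ n)%C. ring. }
  assert (HA : is_series (V := C_NormedModule)
    (fun n => c n * (Cpow (z + h) n - Cpow z n - RtoC (INR n) * Cpow z (pred n) * h))%C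
    (f (z + h) - f z - l * h)%C).
  { assert (H1 := is_series_minus _ _ _ _ (Hf (z + h)%C ltac:(lra)) (Hf z Hz)).
    assert (H2 := is_series_minus _ _ _ _ H1 (is_series_scal h _ _ Hd)).
    replace (f (z + h) - f z - l * h)%C with (f (z + h) - f z - h * l)%C by ring.
    apply is_series_ext with (2 := H2). intros n.
    change (c n * (z + h) ^ n - c n * z ^ n - h * (c n * RtoC (INR n) * z ^ pred n)
      = c n * ((z + h) ^ n - z ^ n - RtoC (INR n) * z ^ pred n * h))%C. ring. }
  assert (HB' := is_series_scal_l (K := R_AbsRing) (V := R_NormedModule) (Cmod h ^ 2 * B / s ^ 2) _ _ HQ).
  apply Rle_trans with (Cmod h ^ 2 * B / s ^ 2 * Q).
  - apply (Cmod_is_series_le _ _ _ _ HA HB').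
    intros n. change (Cmod (c n * (Cpow (z + h) n - Cpow z n - RtoC (INR n) * Cpow z (pred n) * h))
      <= Cmod h ^ 2 * B / s ^ 2 * ((INR n + 1) * (INR n + 2) * q ^ n)).
    rewrite Cmod_mult. apply Rmult_le_reg_l with (s ^ 2); [nra|].
    replace (s ^ 2 * (Cmod h ^ 2 * B / s ^ 2 * ((INR n + 1) * (INR n + 2) * q ^ n)))
      with (((INR n + 1) * (INR n + 2) * Cmod h ^ 2) * (B * q ^ n)) by (field; lra).
    assert (P := Cpow_second_order z h s n (Rlt_le _ _ (proj1 (proj1 (proj2 Hs)))) Hzh).
    assert (Hn := pos_INR n). assert (Hc := Cmod_ge_0 (c n)).
    apply Rle_trans with (INR n ^ 2 * Cmod h ^ 2 * (Cmod (c n) * s ^ n)).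
    + replace (INR n ^ 2 * Cmod h ^ 2 * (Cmod (c n) * s ^ n))
        with (Cmod (c n) * (INR n ^ 2 * Cmod h ^ 2 * s ^ n)) by ring.
      rewrite (Rmult_comm (Cmod (c n))), <- Rmult_assoc, (Rmult_comm _ (Cmod (c n))).
      apply Rmult_le_compat_l; assumption.
    + apply Rmult_le_compat; [| |  |apply Hcs].
      * apply Rmult_le_pos; nra.
      * apply Rmult_le_pos; [assumption|apply pow_le; lra].
      * apply Rmult_le_compat_r; nra.
  - replace (Cmod h ^ 2 * B / s ^ 2 * Q) with (K * Cmod h * Cmod h) by (unfold K; field; lra).
    apply Rmult_le_compat_r; lra.
Qed.

Lemma has_ps_cderiv_at (r : R) (f : C -> C) (c : nat -> C) (z : C) :
  has_ps r f c -> Cmod z < r -> cderiv_at f z (Cderiv f z).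
Proof.
  intros H Hz. destruct (has_ps_termwise_derivative r f c z H Hz) as [l [_ Hl]].
  rewrite (Cderiv_eq f z l Hl). exact Hl.
Qed.

Lemma has_ps_Cderiv (r : R) (f : C -> C) (c : nat -> C) :
  has_ps r f c -> has_ps r (Cderiv f) (dcoef c).
Proof.
  intros H z Hz. destruct (has_ps_termwise_derivative r f c z H Hz) as [l [Hl Hd]].
  rewrite (Cderiv_eq f z l Hd). exact Hl.
Qed.

Lemma has_ps_analytic (f : C -> C) (c : nat -> C) : has_ps 1 f c -> analytic_disk f.
Proof. intros H z Hz. exists (Cderiv f z). exact (has_ps_cderiv_at 1 f c z H Hz). Qed.

(** * Circle integrals and coefficient estimates *)

(** r e^(it), in the same pair form as the argument inside [Mp], so that the two are convertible. *)
Definition circ (r t : R) : C := (r * cos t, r * sin t).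

Lemma circ_mult (r s x y : R) : (circ r x * circ s y)%C = circ (r * s) (x + y).
Proof. unfold circ, Cmult; simpl. rewrite cos_plus, sin_plus. f_equal; ring. Qed.

Lemma circ_0 (r : R) : circ r 0 = RtoC r.
Proof. unfold circ, RtoC. rewrite cos_0, sin_0. f_equal; ring. Qed.

Lemma Cmod_circ (r t : R) : 0 <= r -> Cmod (circ r t) = r.
Proof.
  intros Hr. unfold Cmod, circ; simpl fst; simpl snd.
  replace ((r * cos t) ^ 2 + (r * sin t) ^ 2) with (r ^ 2 * (Rsqr (sin t) + Rsqr (cos t)))
    by (unfold Rsqr; ring).
  rewrite sin2_cos2, Rmult_1_r. apply sqrt_pow2, Hr.
Qed.

Lemma circ_pow (r t : R) (n : nat) : Cpow (circ r t) n = circ (r ^ n) (INR n * t).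
Proof.
  induction n as [|n IH].
  - simpl INR. rewrite Rmult_0_l, circ_0. reflexivity.
  - rewrite Cpow_S, IH, circ_mult, S_INR. simpl. f_equal. ring.
Qed.

Lemma circ_inv (r t : R) : 0 < r -> (/ circ r t)%C = circ (/ r) (- t).
Proof.
  intros Hr.
  assert (H : circ r t <> 0).
  { intros E. assert (E' : Cmod (circ r t) = r) by (apply Cmod_circ; lra).
    rewrite E, Cmod_0 in E'. lra. }
  replace (circ (/ r) (- t)) with (/ circ r t * (circ r t * circ (/ r) (- t)))%C by (field; exact H).
  rewrite circ_mult, Rplus_opp_r, circ_0, Rinv_r by lra. ring.
Qed.

Lemma Ccont_circ {U : UniformSpace} (r : R) (u : U -> R) (x : U) :
  continuous u x -> Ccont (fun y => circ r (u y)) x.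
Proof.
  intros H. split; simpl.
  - apply (continuous_mult (K := R_AbsRing)); [apply continuous_const|].
    apply (continuous_comp u cos); [exact H|].
    apply continuity_pt_filterlim, continuity_cos.
  - apply (continuous_mult (K := R_AbsRing)); [apply continuous_const|].
    apply (continuous_comp u sin); [exact H|].
    apply continuity_pt_filterlim, continuity_sin.
Qed.

Lemma is_RInt_circ (k : C) (s m : R) :
  m <> 0 -> cos (m * (2 * PI)) = 1 -> sin (m * (2 * PI)) = 0 ->
  is_RInt (fun t => Re (k * circ s (m * t))) 0 (2 * PI) 0.
Proof.
  intros Hm Hc Hs.
  (* The real part of k s e^(imt) / (i m). *)
  set (F := fun t => s / m * (Re k * sin (m * t) + Im k * cos (m * t))).
  replace 0 with (minus (F (2 * PI)) (F 0)) at 2.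
  2: { change (F (2 * PI) - F 0 = 0). unfold F.
       rewrite Hc, Hs, (Rmult_0_r m), sin_0, cos_0. ring. }
  apply (is_RInt_derive (V := R_CompleteNormedModule) F).
  - intros t _. unfold F. auto_derive; [trivial|]. unfold circ, Cmult, Re, Im; simpl. field. exact Hm.
  - intros t _. refine (proj1 (Ccont_mult (fun _ => k) (fun t => circ s (m * t)) t _ _)).
    + apply Ccont_const.
    + apply Ccont_circ. apply (continuous_mult (K := R_AbsRing)); [apply continuous_const|apply continuous_id].
Qed.

Lemma cos_sin_int_period (j k : nat) :
  cos ((INR j - INR k) * (2 * PI)) = 1 /\ sin ((INR j - INR k) * (2 * PI)) = 0.
Proof.
  assert (E : forall n, cos (INR n * (2 * PI)) = 1 /\ sin (INR n * (2 * PI)) = 0).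
  { intros n. assert (H1 := cos_period 0 n). assert (H2 := sin_period 0 n).
    rewrite cos_0 in H1. rewrite sin_0 in H2.
    replace (0 + 2 * INR n * PI) with (INR n * (2 * PI)) in * by ring. split; assumption. }
  rewrite Rmult_minus_distr_r, cos_minus, sin_minus.
  destruct (E j) as [-> ->]. destruct (E k) as [-> ->]. split; ring.
Qed.

Lemma is_RInt_circ_nat (k : C) (s : R) (j n : nat) :
  is_RInt (fun t => Re (k * circ s ((INR j - INR n) * t))) 0 (2 * PI)
    ((if Nat.eqb j n then 2 * PI * Re (k * RtoC s) else 0) : R).
Proof.
  destruct (Nat.eqb_spec j n) as [->|Hne].
  - apply is_RInt_ext with (fun _ => Re (k * RtoC s)).
    { intros t _. rewrite Rminus_diag, Rmult_0_l, circ_0. reflexivity. }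
    replace (2 * PI * Re (k * RtoC s)) with (scal (2 * PI - 0) (Re (k * RtoC s)))
      by (unfold scal; simpl; unfold mult; simpl; ring).
    apply (is_RInt_const (V := R_NormedModule)).
  - destruct (cos_sin_int_period j n) as [H1 H2]. apply is_RInt_circ; try assumption.
    intros E. apply Hne, INR_eq. lra.
Qed.

(** Orthogonality of the exponentials: multiplying by e^(-int) isolates the coefficient of index
    [n], provided the partial sum already reaches it. *)
Lemma is_RInt_partial_sum (c : nat -> C) (r : R) (k : C) (n N : nat) :
  is_RInt (fun t => Re (k * (sum_n (G := C_NormedModule) (fun j => c j * Cpow (circ r t) j)%C N
      * circ 1 (- (INR n * t))))) 0 (2 * PI)
    ((if Nat.leb n N then 2 * PI * (Re (k * c n) * r ^ n) else 0) : R).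
Proof.
  assert (T : forall j, is_RInt (fun t => Re (k * (c j * Cpow (circ r t) j * circ 1 (- (INR n * t)))))
    0 (2 * PI) ((if Nat.eqb j n then 2 * PI * (Re (k * c n) * r ^ n) else 0) : R)).
  { intros j.
    assert (H := is_RInt_circ_nat (k * c j) (r ^ j) j n).
    assert (E : (if Nat.eqb j n then 2 * PI * Re (k * c j * RtoC (r ^ j)) else 0)
      = (if Nat.eqb j n then 2 * PI * (Re (k * c n) * r ^ n) else 0))
      by (destruct (Nat.eqb_spec j n) as [E|E]; [rewrite E, re_scal_r|]; reflexivity).
    rewrite E in H.
    apply is_RInt_ext with (2 := H). intros t _. rewrite circ_pow, <- (Cmult_assoc (c j)), circ_mult.
    rewrite Cmult_assoc. do 3 f_equal; ring. }
  induction N as [|N IH].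
  - specialize (T O). change (Nat.eqb 0 n) with (match n with O => true | _ => false end) in T.
    replace (Nat.leb n 0) with (match n with O => true | _ => false end) by (destruct n; reflexivity).
    apply is_RInt_ext with (2 := T). intros t _. rewrite sum_O. reflexivity.
  - assert (P := is_RInt_plus _ _ _ _ _ _ IH (T (S N))).
    replace (if Nat.leb n (S N) then 2 * PI * (Re (k * c n) * r ^ n) else 0)
      with (plus (if Nat.leb n N then 2 * PI * (Re (k * c n) * r ^ n) else 0)
        (if Nat.eqb (S N) n then 2 * PI * (Re (k * c n) * r ^ n) else 0)).
    2: { unfold plus; cbn -[Nat.leb Nat.eqb].
         destruct (Nat.leb_spec n N), (Nat.leb_spec n (S N)), (Nat.eqb_spec (S N) n);
         try lia; ring. }
    apply is_RInt_ext with (2 := P). intros t _. rewrite sum_Sn.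
    set (x := sum_n (G := C_NormedModule) (fun j => c j * Cpow (circ r t) j)%C N).
    set (y := (c (S N) * Cpow (circ r t) (S N))%C). set (e := circ 1 (- (INR n * t))).
    transitivity (Re (k * (x * e) + k * (y * e))%C); [reflexivity|].
    apply (f_equal Re). change (k * (x * e) + k * (y * e) = k * ((x + y) * e))%C. ring.
Qed.

Lemma Cmod_is_series_tail_le (a : nat -> C) (b : nat -> R) (l : C) (s : R) (n : nat) :
  is_series (V := C_NormedModule) a l -> is_series b s ->
  (forall n, Cmod (a n) <= b n) ->
  Cmod (l - sum_n (G := C_NormedModule) a n) <= s - sum_n b n.
Proof.
  intros Ha Hb H.
  apply Cmod_is_series_le with (fun k => a (S n + k)%nat) (fun k => b (S n + k)%nat).
  - apply (is_series_incr_n (V := C_NormedModule)); [lia|]. simpl pred.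
    match goal with |- is_series _ ?x => replace x with l; [exact Ha|] end.
    change (l = l - sum_n (G := C_NormedModule) a n + sum_n (G := C_NormedModule) a n)%C. ring.
  - apply (is_series_incr_n (V := R_NormedModule)); [lia|]. simpl pred.
    match goal with |- is_series _ ?x => replace x with s; [exact Hb|] end.
    change (s = s - sum_n b n + sum_n b n). ring.
  - intros k. apply H.
Qed.

Lemma ex_RInt_continuous_R (u : R -> R) (a b : R) : (forall t, continuous u t) -> ex_RInt u a b.
Proof. intros H. apply (ex_RInt_continuous (V := R_CompleteNormedModule)). intros; apply H. Qed.

Lemma two_PI_pos : 0 < 2 * PI.
Proof. generalize PI_RGT_0; lra. Qed.

(** The number c_n r^n is the mean of f(r e^(it)) e^(-int). Instead of integrating a series, the
    partial sums are integrated exactly; on the circle they differ from [f] by at most a geometric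
    tail, which disappears as N grows. *)
Lemma has_ps_coef_le (R0 r : R) (f : C -> C) (c : nat -> C) (n : nat) :
  has_ps R0 f c -> 0 < r < R0 ->
  2 * PI * (Cmod (c n) * r ^ n) <= RInt (fun t => Cmod (f (circ r t))) 0 (2 * PI).
Proof.
  intros Hf Hr. assert (HPI := two_PI_pos).
  assert (Hin : forall t, Cmod (circ r t) < R0) by (intros t; rewrite Cmod_circ; lra).
  assert (Hcont : forall t, Ccont (fun t => f (circ r t)) t).
  { intros t. apply (Ccont_comp f (circ r) t (Cderiv f (circ r t))).
    - apply (has_ps_cderiv_at _ _ _ _ Hf), Hin.
    - apply (Ccont_circ r (fun t => t)), continuous_id. }
  assert (HI : is_RInt (fun t => Cmod (f (circ r t))) 0 (2 * PI) (RInt (fun t => Cmod (f (circ r t))) 0 (2 * PI))).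
  { apply (RInt_correct (V := R_CompleteNormedModule)). apply ex_RInt_continuous_R.
    intros t. apply continuous_Cmod, Hcont. }
  set (I := RInt _ _ _) in *.
  assert (Hc0 := Cmod_ge_0 (c n)).
  (* [k] is the conjugate phase of [c n], or 0 if [c n] vanishes; it turns the modulus into a real
     part. *)
  assert (Hk : exists k, Cmod k <= 1 /\ Re (k * c n) = Cmod (c n)).
  { destruct (Req_dec (Cmod (c n)) 0) as [E|E].
    - exists (RtoC 0). rewrite E, Cmod_0. split; [lra|]. rewrite Cmult_0_l. reflexivity.
    - exists (Cconj (c n) * RtoC (/ Cmod (c n)))%C. split.
      + rewrite Cmod_mult, Cmod_conj, Cmod_R, Rabs_pos_eq.
        * rewrite Rinv_r by exact E. lra.
        * left. apply Rinv_0_lt_compat. lra.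
      + replace (Cconj (c n) * RtoC (/ Cmod (c n)) * c n)%C
          with (RtoC (/ Cmod (c n)) * (c n * Cconj (c n)))%C by ring.
        rewrite <- Cmod2_conj, <- RtoC_mult, re_RtoC. field. exact E. }
  destruct Hk as [k [Hk1 Hk2]].
  set (s := (r + R0) / 2). set (q := r / s).
  assert (Hs : r < s < R0) by (unfold s; lra).
  destruct (has_ps_bounded R0 s f c Hf) as [B [HB0 HB]]; [lra|].
  assert (Hq : 0 <= q < 1).
  { unfold q; split; [apply Rdiv_le_0_compat; lra|apply Rlt_div_l; lra]. }
  assert (Hcs : forall j, Cmod (c j) * r ^ j <= B * q ^ j).
  { intros j. replace (r ^ j) with (s ^ j * q ^ j).
    2: { unfold q. rewrite <- Rpow_mult_distr. f_equal. field. lra. }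
    rewrite <- Rmult_assoc. apply Rmult_le_compat_r; [apply pow_le; lra|apply HB]. }
  assert (HS : ex_series (fun j => B * q ^ j)).
  { apply (ex_series_scal (V := R_NormedModule) B), ex_series_geom. rewrite Rabs_pos_eq; lra. }
  destruct HS as [S HS].
  assert (HN : forall N, (n <= N)%nat ->
    2 * PI * (Cmod (c n) * r ^ n) <= I + 2 * PI * (S - sum_n (fun j => B * q ^ j) N)).
  { intros N HnN. assert (P := is_RInt_partial_sum c r k n N).
    rewrite (proj2 (Nat.leb_le n N) HnN), Hk2 in P.
    set (d := S - sum_n (fun j => B * q ^ j) N).
    assert (Q : is_RInt (fun _ => d) 0 (2 * PI) (2 * PI * d)).
    { replace (2 * PI * d) with (scal (2 * PI - 0) d) by (unfold scal; simpl; unfold mult; simpl; ring).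
      apply (is_RInt_const (V := R_NormedModule)). }
    refine (is_RInt_le _ _ 0 (2 * PI) _ _ (Rlt_le _ _ HPI) P (is_RInt_plus _ _ _ _ _ _ HI Q) _).
    intros t _. change (plus (Cmod (f (circ r t))) d) with (Cmod (f (circ r t)) + d).
    set (SN := sum_n (G := C_NormedModule) (fun j => c j * Cpow (circ r t) j)%C N : C).
    assert (E : Cmod (f (circ r t) - SN) <= d).
    { apply (Cmod_is_series_tail_le _ _ _ _ _ (Hf _ (Hin t)) HS).
      intros j. rewrite Cmod_mult, Cmod_pow, Cmod_circ by lra. apply Hcs. }
    eapply Rle_trans; [apply Rle_abs|]. eapply Rle_trans; [apply re_le_Cmod|].
    rewrite !Cmod_mult, (Cmod_circ 1) by lra.
    apply Rle_trans with (Cmod SN).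
    { assert (H := Cmod_ge_0 SN). assert (H' := Cmod_ge_0 k). nra. }
    replace SN with (f (circ r t) + - (f (circ r t) - SN))%C by ring.
    eapply Rle_trans; [apply Cmod_triangle|]. rewrite Cmod_opp. lra. }
  apply (is_lim_seq_le_loc (fun _ => 2 * PI * (Cmod (c n) * r ^ n))
    (fun N => I + 2 * PI * (S - sum_n (fun j => B * q ^ j) N)) (2 * PI * (Cmod (c n) * r ^ n)) I).
  - exists n. exact HN.
  - apply is_lim_seq_const.
  - replace (Finite I) with (Finite (I + 2 * PI * (S - S))) by (f_equal; ring).
    apply is_lim_seq_plus'; [apply is_lim_seq_const|].
    apply (is_lim_seq_scal_l _ (2 * PI) (S - S)).
    apply is_lim_seq_minus'; [apply is_lim_seq_const|exact HS].
Qed.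

(** The zero function f - f has the coefficients c - d, and the estimate by the circular mean makes
    them vanish. *)
Lemma has_ps_unique (R0 : R) (f : C -> C) (c d : nat -> C) (n : nat) :
  0 < R0 -> has_ps R0 f c -> has_ps R0 f d -> c n = d n.
Proof.
  intros HR Hc Hd. assert (H := has_ps_minus _ _ _ _ _ Hc Hd).
  assert (L := has_ps_coef_le R0 (R0 / 2) _ _ n H ltac:(lra)).
  rewrite (RInt_ext _ (fun _ => 0)), (RInt_const (V := R_CompleteNormedModule)) in L.
  2: { intros t _. replace (f (circ (R0 / 2) t) - f (circ (R0 / 2) t))%C with (RtoC 0) by ring. apply Cmod_0. }
  change (2 * PI * (Cmod (c n - d n) * (R0 / 2) ^ n) <= (2 * PI - 0) * 0) in L.
  assert (HP := two_PI_pos). assert (0 < (R0 / 2) ^ n) by (apply pow_lt; lra).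
  assert (E : Cmod (c n - d n) = 0).
  { assert (G := Cmod_ge_0 (c n - d n)).
    assert (0 < 2 * PI * (R0 / 2) ^ n) by nra. nra. }
  apply Cmod_eq_0 in E. replace (c n) with (c n - d n + d n)%C by ring. rewrite E. ring.
Qed.

(** * Power series expansion of analytic functions *)

Lemma is_derive_affine (a b s : R) : is_derive (fun u => a + u * b) s b.
Proof. auto_derive; [trivial|ring]. Qed.

Section Cauchy.
Variable f : C -> C.
Hypothesis Hf : analytic_disk f.
Hypothesis Hf' : analytic_disk (Cderiv f).
Variables (rho : R) (z k : C).
Hypothesis Hrho : rho < 1.
Hypothesis Hz : Cmod z < rho.

Let w (t : R) : C := circ rho t.
(** Cauchy's kernel in the parameter t: dw / (w - z) equals i [ker t] dt, and the factor i is
    dropped. *)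
Let ker (t : R) : C := (w t * / (w t - z))%C.
Let path (s t : R) : C := (z + RtoC s * (w t - z))%C.

Lemma cauchy_rho_pos : 0 < rho.
Proof. generalize (Cmod_ge_0 z); lra. Qed.

Lemma cauchy_ker_nz (t : R) : (w t - z)%C <> 0.
Proof.
  intros E. assert (E' : Cmod (w t) = rho) by (apply Cmod_circ; generalize cauchy_rho_pos; lra).
  replace (w t) with (w t - z + z)%C in E' by ring. rewrite E in E'.
  replace (0 + z)%C with z in E' by ring. lra.
Qed.

Lemma cauchy_ker_cont {U : UniformSpace} (u : U -> R) (x : U) :
  continuous u x -> Ccont (fun y => ker (u y)) x.
Proof.
  intros Hu. apply Ccont_mult; [apply Ccont_circ, Hu|].
  apply Ccont_inv; [apply cauchy_ker_nz|].
  apply Ccont_minus; [apply Ccont_circ, Hu|apply Ccont_const].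
Qed.

Lemma cauchy_path_cont {U : UniformSpace} (u v : U -> R) (x : U) :
  continuous u x -> continuous v x -> Ccont (fun y => path (u y) (v y)) x.
Proof.
  intros Hu Hv. apply Ccont_plus; [apply Ccont_const|]. apply Ccont_mult; [apply Ccont_RtoC, Hu|].
  apply Ccont_minus; [apply Ccont_circ, Hv|apply Ccont_const].
Qed.

(** Derivatives in s at the endpoints 0 and 1 are two-sided, so the segments must stay in the disk
    slightly beyond them. With e = (1 - rho)/4 the modulus is below rho + 2 e rho < 1. *)
Lemma cauchy_path_disk (s t : R) :
  - ((1 - rho) / 4) < s < 1 + (1 - rho) / 4 -> in_disk (path s t).
Proof.
  intros Hs. unfold in_disk. assert (Hr := cauchy_rho_pos). assert (Hz0 := Cmod_ge_0 z).
  replace (path s t) with (RtoC (1 - s) * z + RtoC s * w t)%C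
    by (unfold path; rewrite RtoC_minus; ring).
  eapply Rle_lt_trans; [apply Cmod_triangle|].
  rewrite !Cmod_mult, !Cmod_R. unfold w; rewrite Cmod_circ by lra.
  unfold Rabs. destruct (Rcase_abs (1 - s)), (Rcase_abs s); nra.
Qed.

(** The s-derivative of the path is w - z, which cancels the denominator of the kernel. *)
Lemma cauchy_deriv_s (s t : R) :
  in_disk (path s t) ->
  is_derive (fun u => Re (k * ker t * f (path u t))) s
    (Re (k * (Cderiv f (path s t) * w t))).
Proof.
  intros H.
  replace (k * (Cderiv f (path s t) * w t))%C
    with (k * ker t * (Cderiv f (path s t) * (w t - z)))%C
    by (unfold ker; field; apply cauchy_ker_nz).
  apply (is_derive_Re_comp f (fun u => path u t)).
  - apply Cderiv_correct; assumption.
  - unfold path. apply is_derive_ext with (fun u => Re z + u * Re (w t - z)).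
    { intros u. rewrite re_plus, re_scal_l. reflexivity. }
    apply is_derive_affine.
  - unfold path. apply is_derive_ext with (fun u => Im z + u * Im (w t - z)).
    { intros u. rewrite im_plus, im_scal_l. reflexivity. }
    apply is_derive_affine.
Qed.

(** The t-derivative of the path is i s w, so for s <> 0 a primitive is f(path)/(i s), with equal
    values at both ends of the period. At s = 0 this primitive degenerates, but the integrand is a
    constant times w, whose mean is 0. *)
Lemma cauchy_deriv_integral (s : R) :
  0 <= s <= 1 ->
  is_RInt (fun t => Re (k * (Cderiv f (path s t) * w t))) 0 (2 * PI) 0.
Proof.
  intros Hs. destruct (Req_dec s 0) as [->|Hs0].
  - apply is_RInt_ext with (fun t => Re (k * Cderiv f z * circ rho (1 * t))).
    { intros t _. rewrite Rmult_1_l. unfold path. replace (z + RtoC 0 * (w t - z))%C with z by ring.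
      f_equal. unfold w. ring. }
    assert (P := cos_sin_int_period 1 0). rewrite Rminus_0_r in P. simpl INR in P.
    apply is_RInt_circ; [lra| |]; apply P.
  - set (F := fun t => Re (k * / (Ci * RtoC s) * f (path s t))).
    replace 0 with (minus (F (2 * PI)) (F 0)) at 2.
    2: { assert (E : path s (2 * PI) = path s 0).
         { unfold path, w, circ. rewrite cos_2PI, sin_2PI, cos_0, sin_0. reflexivity. }
         unfold F. rewrite E. apply Rminus_diag. }
    assert (Hin : forall t, in_disk (path s t)) by (intros t; apply cauchy_path_disk; lra).
    assert (HC : (Ci * RtoC s <> 0)%C).
    { apply Cmult_neq_0; [intros E; injection E; lra|intros E; apply RtoC_inj in E; lra]. }
    apply (is_RInt_derive (V := R_CompleteNormedModule) F).
    + intros t _.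
      replace (k * (Cderiv f (path s t) * w t))%C
        with (k * / (Ci * RtoC s) * (Cderiv f (path s t) * (Ci * RtoC s * w t)))%C
        by (field; split; intros E; apply HC; rewrite E; ring).
      apply (is_derive_Re_comp f (path s)).
      * apply Cderiv_correct; [assumption|apply Hin].
      * apply is_derive_ext with (fun t => Re z + s * (rho * cos t - Re z)).
        { intros u. unfold path. rewrite re_plus, re_scal_l, re_minus. reflexivity. }
        auto_derive; [trivial|]. unfold w, circ, Ci, Cmult, RtoC, Re; simpl. ring.
      * apply is_derive_ext with (fun t => Im z + s * (rho * sin t - Im z)).
        { intros u. unfold path. rewrite im_plus, im_scal_l, im_minus. reflexivity. }
        auto_derive; [trivial|]. unfold w, circ, Ci, Cmult, RtoC, Im; simpl. ring.
    + intros t _. refine (proj1 (Ccont_mult (fun _ => k) (fun t => Cderiv f (path s t) * w t)%C t _ _)).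
      * apply Ccont_const.
      * apply Ccont_mult.
        -- apply (Ccont_comp (Cderiv f) (path s) t (Cderiv (Cderiv f) (path s t))).
           ++ apply Cderiv_correct; [assumption|apply Hin].
           ++ apply (cauchy_path_cont (fun _ => s) (fun t => t));
                [apply continuous_const|apply continuous_id].
        -- apply (Ccont_circ rho (fun t => t)), continuous_id.
Qed.

Let G (s : R) : R := RInt (fun t => Re (k * ker t * f (path s t))) 0 (2 * PI).

Lemma cauchy_G_deriv (s : R) : 0 <= s <= 1 -> is_derive G s 0.
Proof.
  intros Hs. assert (Hr := cauchy_rho_pos).
  assert (Hloc : locally s (fun y => forall t, in_disk (path y t))).
  { assert (Hd : 0 < (1 - rho) / 4) by lra. exists (mkposreal _ Hd).
    intros y Hy t. apply cauchy_path_disk.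
    change (Rabs (y - s) < (1 - rho) / 4) in Hy. apply Rabs_def2 in Hy. lra. }
  assert (E : RInt (fun t => Derive (fun u => Re (k * ker t * f (path u t))) s) 0 (2 * PI) = 0).
  { apply is_RInt_unique. apply is_RInt_ext with (2 := cauchy_deriv_integral s Hs).
    intros t _. symmetry. apply is_derive_unique, cauchy_deriv_s, cauchy_path_disk. lra. }
  rewrite <- E.
  apply (is_derive_RInt_param (fun s t => Re (k * ker t * f (path s t)))).
  - generalize Hloc. apply filter_imp. intros y Hy t _. eexists. apply cauchy_deriv_s, Hy.
  (* Differentiation under the integral asks for joint continuity of the s-derivative; the
     derivative of [f] is continuous because it is itself differentiable. *)
  - intros t _.
    apply continuity_2d_pt_ext_loc with (fun u v => Re (k * (Cderiv f (path u v) * w v))).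
    + destruct Hloc as [d Hd]. exists d. intros u v Hu Hv. symmetry.
      apply is_derive_unique, cauchy_deriv_s, (Hd u Hu).
    + apply continuity_2d_pt_filterlim.
      assert (H1 : continuous (fun y : R * R => fst y) (s, t)) by apply continuous_fst.
      assert (H2 : continuous (fun y : R * R => snd y) (s, t)) by apply continuous_snd.
      refine (proj1 (Ccont_mult (fun _ => k)
        (fun y : R * R => Cderiv f (path (fst y) (snd y)) * w (snd y))%C (s, t) _ _)).
      * apply Ccont_const.
      * apply Ccont_mult; [|apply Ccont_circ, H2].
        apply (Ccont_comp (Cderiv f) (fun y : R * R => path (fst y) (snd y)) (s, t)
          (Cderiv (Cderiv f) (path s t))).
        -- apply Cderiv_correct; [assumption|]. apply cauchy_path_disk. lra.
        -- apply cauchy_path_cont; assumption.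
  - generalize Hloc. apply filter_imp. intros y Hy. apply ex_RInt_continuous_R. intros t.
    refine (proj1 (Ccont_mult (fun t => k * ker t)%C (fun t => f (path y t)) t _ _)).
    + apply Ccont_mult; [apply Ccont_const|]. apply (cauchy_ker_cont (fun t => t)), continuous_id.
    + apply (Ccont_comp f (path y) t (Cderiv f (path y t))).
      * apply Cderiv_correct; [assumption|apply Hy].
      * apply (cauchy_path_cont (fun _ => y) (fun t => t)); [apply continuous_const|apply continuous_id].
Qed.

(* The circle |w| = rho is contracted onto z; the derivative in s of the integral below
   is the integral of a total derivative in t. *)
Lemma cauchy_integral :
  RInt (fun t => Re (k * (w t * / (w t - z)) * f (w t))) 0 (2 * PI)
  = RInt (fun t => Re (k * (w t * / (w t - z)) * f z)) 0 (2 * PI).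
Proof.
  assert (E : G 0 = G 1).
  { apply (eq_is_derive (V := R_NormedModule) G 0 1); [|lra].
    intros s Hs. apply cauchy_G_deriv, Hs. }
  unfold G in E. symmetry. rewrite (RInt_ext _ (fun t => Re (k * ker t * f (path 0 t)))).
  2: { intros t _. unfold path, ker. do 3 f_equal. ring. }
  rewrite E. apply RInt_ext. intros t _. unfold path, ker. do 3 f_equal. ring.
Qed.

End Cauchy.

(** * Fourier coefficients and the expansion of the Cauchy kernel *)

Definition circ_RInt (g : R -> C) : C :=
  (RInt (fun t => Re (g t)) 0 (2 * PI), RInt (fun t => Im (g t)) 0 (2 * PI)).

Lemma Re_circ_RInt (g : R -> C) (k : C) :
  (forall t, Ccont g t) ->
  is_RInt (fun t => Re (k * g t)) 0 (2 * PI) (Re (k * circ_RInt g)).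
Proof.
  intros H.
  assert (H1 := RInt_correct (V := R_CompleteNormedModule) _ _ _
    (ex_RInt_continuous_R (fun t => Re (g t)) 0 (2 * PI) (fun t => proj1 (H t)))).
  assert (H2 := RInt_correct (V := R_CompleteNormedModule) _ _ _
    (ex_RInt_continuous_R (fun t => Im (g t)) 0 (2 * PI) (fun t => proj2 (H t)))).
  exact (is_RInt_minus _ _ _ _ _ _ (is_RInt_scal _ _ _ (Re k) _ H1) (is_RInt_scal _ _ _ (Im k) _ H2)).
Qed.

(** For [g t = f (circ rho t)] this is Cauchy's coefficient integral, 1/(2 pi i) times the integral
    of f(w) w^(-n-1) dw, since dw = i w dt. *)
Definition fourier (rho : R) (g : R -> C) (n : nat) : C :=
  (RtoC (/ (2 * PI)) * circ_RInt (fun t => g t * Cpow (/ circ rho t) n))%C.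

Lemma Ccont_inv_circ_pow (rho t : R) (n : nat) :
  0 < rho -> Ccont (fun t => Cpow (/ circ rho t) n)%C t.
Proof.
  intros Hr. apply Ccont_pow. apply Ccont_inv.
  - intros E. assert (E' := Cmod_circ rho t ltac:(lra)). rewrite E, Cmod_0 in E'. lra.
  - apply (Ccont_circ rho (fun t => t)), continuous_id.
Qed.

Lemma Re_fourier (rho : R) (g : R -> C) (k : C) (n : nat) :
  0 < rho -> (forall t, Ccont g t) ->
  is_RInt (fun t => Re (k * (g t * Cpow (/ circ rho t) n))) 0 (2 * PI)
    (2 * PI * Re (k * fourier rho g n)).
Proof.
  intros Hr Hg. assert (HP := two_PI_pos).
  replace (2 * PI * Re (k * fourier rho g n))
    with (Re (k * circ_RInt (fun t => g t * Cpow (/ circ rho t) n)%C)).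
  - apply Re_circ_RInt. intros t. apply Ccont_mult; [apply Hg|apply Ccont_inv_circ_pow, Hr].
  - unfold fourier.
    replace (k * (RtoC (/ (2 * PI)) * circ_RInt (fun t => g t * Cpow (/ circ rho t) n)))%C
      with (RtoC (/ (2 * PI)) * (k * circ_RInt (fun t => g t * Cpow (/ circ rho t) n)))%C by ring.
    rewrite re_scal_l. field. generalize PI_RGT_0; lra.
Qed.

Lemma fourier_const (rho : R) (c : C) (n : nat) :
  0 < rho -> fourier rho (fun _ => c) n = (if Nat.eqb n 0 then c else RtoC 0).
Proof.
  intros Hr. assert (HP := PI_RGT_0).
  assert (A : forall k, Re (k * fourier rho (fun _ => c) n) = Re (k * (if Nat.eqb n 0 then c else RtoC 0))).
  { intros k. assert (H := Re_fourier rho (fun _ => c) k n Hr (fun t => Ccont_const c t)).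
    assert (H' := is_RInt_circ_nat (k * c) ((/ rho) ^ n) 0 n).
    apply (is_RInt_unique (V := R_CompleteNormedModule)) in H, H'.
    rewrite (RInt_ext _ (fun t => Re (k * c * circ ((/ rho) ^ n) ((INR 0 - INR n) * t)))) in H.
    2: { intros t _. rewrite circ_inv, circ_pow by exact Hr.
         replace (INR n * - t) with ((INR 0 - INR n) * t) by (simpl; ring). f_equal. ring. }
    rewrite H' in H.
    destruct n as [|n].
    - change (2 * PI * Re (k * c * 1) = 2 * PI * Re (k * fourier rho (fun _ => c) 0)) in H.
      change (Re (k * fourier rho (fun _ => c) 0) = Re (k * c)). rewrite Cmult_1_r in H.
      apply Rmult_eq_reg_l with (2 * PI); lra.
    - change (0 = 2 * PI * Re (k * fourier rho (fun _ => c) (S n))) in H.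
      change (Re (k * fourier rho (fun _ => c) (S n)) = Re (k * 0)). rewrite Cmult_0_r.
      change (Re 0) with 0. apply Rmult_eq_reg_l with (2 * PI); lra. }
  (* [k = 1] gives the real part and [k = -i] the imaginary part, because Re(-i x) = Im x. *)
  assert (A1 := A 1%C). rewrite !Cmult_1_l in A1.
  assert (A2 := A (- Ci)%C).
  assert (E : forall x, Re (- Ci * x) = Im x) by (intros x; unfold Ci, Cmult, Copp, Re, Im; simpl; ring).
  rewrite !E in A2. apply injective_projections; assumption.
Qed.

(** The finite geometric sum w/(w - z) = sum of (z/w)^n for n <= N, plus (z/w)^(N+1) w/(w - z), is
    integrated against [g]. On the circle |z/w| = |z|/rho and |w/(w - z)| <= rho/(rho - |z|). *)
Lemma cauchy_kernel_expansion (rho : R) (z : C) (g : R -> C) (k : C) (N : nat) :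
  Cmod z < rho -> (forall t, Ccont g t) -> Cmod k <= 1 ->
  Rabs (RInt (fun t => Re (k * (circ rho t * / (circ rho t - z)) * g t)) 0 (2 * PI)
    - 2 * PI * Re (k * sum_n (G := C_NormedModule) (fun n => fourier rho g n * Cpow z n)%C N))
  <= (Cmod z / rho) ^ S N * (rho / (rho - Cmod z)) * RInt (fun t => Cmod (g t)) 0 (2 * PI).
Proof.
  intros Hz Hg Hk. assert (Hz0 := Cmod_ge_0 z). assert (Hr : 0 < rho) by lra.
  assert (HP := two_PI_pos).
  assert (Hw : forall t, Cmod (circ rho t) = rho) by (intros t; apply Cmod_circ; lra).
  assert (Hw0 : forall t, circ rho t <> 0).
  { intros t E. specialize (Hw t). rewrite E, Cmod_0 in Hw. lra. }
  assert (Hwz : forall t, rho - Cmod z <= Cmod (circ rho t - z)).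
  { intros t. assert (T := Cmod_triangle (circ rho t - z) z).
    replace (circ rho t - z + z)%C with (circ rho t) in T by ring. rewrite Hw in T. lra. }
  assert (Hwz0 : forall t, (circ rho t - z)%C <> 0).
  { intros t E. specialize (Hwz t). rewrite E, Cmod_0 in Hwz. lra. }
  set (ker := fun t => (circ rho t * / (circ rho t - z))%C).
  assert (Hcirc : forall t, Ccont (circ rho) t).
  { intros t. apply (Ccont_circ rho (fun t => t)), continuous_id. }
  assert (Hker : forall t, Ccont ker t).
  { intros t. apply Ccont_mult; [apply Hcirc|]. apply Ccont_inv; [apply Hwz0|].
    apply Ccont_minus; [apply Hcirc|apply Ccont_const]. }
  set (rem := fun t => Re (k * ((z * / circ rho t) ^ S N * ker t) * g t)).
  assert (Hremc : forall t, continuous rem t).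
  { intros t. refine (proj1 (Ccont_mult (fun t => k * ((z * / circ rho t) ^ S N * ker t))%C g t _ (Hg t))).
    apply Ccont_mult; [apply Ccont_const|]. apply Ccont_mult; [|apply Hker].
    apply Ccont_pow. apply Ccont_mult; [apply Ccont_const|]. apply Ccont_inv; [apply Hw0|apply Hcirc]. }
  assert (Hrem := RInt_correct (V := R_CompleteNormedModule) _ _ _ (ex_RInt_continuous_R rem 0 (2 * PI) Hremc)).
  set (S0 := fun M => sum_n (G := C_NormedModule) (fun n => fourier rho g n * Cpow z n)%C M : C).
  assert (HSS : forall n, S0 (S n) = (S0 n + fourier rho g (S n) * Cpow z (S n))%C).
  { intros n. exact (sum_Sn (G := C_NormedModule) (fun n => fourier rho g n * Cpow z n)%C n). }
  assert (HS : forall M, is_RInt (fun t => Re (k * (ker t - (z * / circ rho t) ^ S M * ker t) * g t)) 0 (2 * PI)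
      (2 * PI * Re (k * S0 M))).
  { assert (Step : forall M t, (ker t - (z * / circ rho t) ^ S M * ker t
        = (ker t - (z * / circ rho t) ^ M * ker t) + z ^ M * (/ circ rho t) ^ M)%C).
    { intros M t. rewrite Cpow_S, <- Cpow_mult_l.
      replace (ker t - (z * / circ rho t) ^ M * ker t + (z * / circ rho t) ^ M)%C
        with (ker t - (z * / circ rho t) ^ M * (ker t - 1))%C by ring.
      replace (ker t - 1)%C with (z * / circ rho t * ker t)%C; [ring|].
      unfold ker. field. split; [apply Hwz0|apply Hw0]. }
    assert (T : forall n, is_RInt (fun t => Re (k * (z ^ n * (/ circ rho t) ^ n) * g t)) 0 (2 * PI)
      (2 * PI * Re (k * (fourier rho g n * Cpow z n)))).
    { intros n. assert (H := Re_fourier rho g (k * z ^ n) n Hr Hg).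
      replace (k * (fourier rho g n * Cpow z n))%C with (k * z ^ n * fourier rho g n)%C by ring.
      apply is_RInt_ext with (2 := H). intros t _. f_equal. ring. }
    intros M. induction M as [|n IH].
    - unfold S0. rewrite sum_O. apply is_RInt_ext with (2 := T O). intros t _.
      rewrite Step. apply (f_equal Re). simpl Cpow. ring.
    - rewrite (HSS n).
      assert (P := is_RInt_plus _ _ _ _ _ _ IH (T (S n))).
      match type of P with is_RInt _ _ _ ?x => replace x with
        (2 * PI * Re (k * (S0 n + fourier rho g (S n) * Cpow z (S n)))) in P end.
      2: { rewrite Cmult_plus_distr_l, re_plus. apply Rmult_plus_distr_l. }
      apply is_RInt_ext with (2 := P). intros t _. rewrite (Step (S n)).
      rewrite Cmult_plus_distr_l, Cmult_plus_distr_r, re_plus. reflexivity. }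
  assert (E : RInt (fun t => Re (k * ker t * g t)) 0 (2 * PI) = 2 * PI * Re (k * S0 N) + RInt rem 0 (2 * PI)).
  { apply is_RInt_unique. apply is_RInt_ext with (2 := is_RInt_plus _ _ _ _ _ _ (HS N) Hrem).
    intros t _. unfold rem.
    match goal with |- plus (Re ?x) (Re ?y) = _ => transitivity (Re (x + y)%C); [reflexivity|] end.
    f_equal. ring. }
  fold (S0 N).
  change (Rabs (RInt (fun t => Re (k * ker t * g t)) 0 (2 * PI) - 2 * PI * Re (k * S0 N))
    <= (Cmod z / rho) ^ S N * (rho / (rho - Cmod z)) * RInt (fun t => Cmod (g t)) 0 (2 * PI)).
  assert (X : forall x y : R, x + y - x = y) by (intros; ring).
  rewrite E, X.
  assert (HI := RInt_correct (V := R_CompleteNormedModule) _ _ _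
    (ex_RInt_continuous_R (fun t => Cmod (g t)) 0 (2 * PI) (fun t => continuous_Cmod g t (Hg t)))).
  refine (norm_RInt_le (V := R_NormedModule) rem _ 0 (2 * PI) _ _ (Rlt_le _ _ HP) _ Hrem
    (is_RInt_scal (V := R_NormedModule) _ _ _ ((Cmod z / rho) ^ S N * (rho / (rho - Cmod z))) _ HI)).
  intros t _. change (Rabs (rem t) <= (Cmod z / rho) ^ S N * (rho / (rho - Cmod z)) * Cmod (g t)).
  unfold rem. eapply Rle_trans; [apply re_le_Cmod|].
  rewrite !Cmod_mult, Cmod_pow, Cmod_mult, (Cmod_inv (circ rho t)), Hw by apply Hw0.
  unfold ker. rewrite Cmod_mult, (Cmod_inv (circ rho t - z)), Hw by apply Hwz0.
  apply Rmult_le_compat_r; [apply Cmod_ge_0|].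
  assert (Hq : 0 <= (Cmod z / rho) ^ S N) by (apply pow_le, Rdiv_le_0_compat; lra).
  apply Rle_trans with (1 * ((Cmod z * / rho) ^ S N * (rho * / Cmod (circ rho t - z)))).
  - apply Rmult_le_compat_r; [|exact Hk]. apply Rmult_le_pos; [exact Hq|].
    apply Rdiv_le_0_compat; [lra|]. specialize (Hwz t); lra.
  - rewrite Rmult_1_l. apply Rmult_le_compat_l; [exact Hq|].
    apply Rmult_le_compat_l; [lra|]. apply Rinv_le_contravar; [lra|apply Hwz].
Qed.

(** The kernel expansion is applied twice, to [f] on the circle and to the constant [f z]. Cauchy's
    formula says that both have the same kernel integral, and the expansion of the constant has
    [f z] as every partial sum. Hence the partial sums of [f] differ from [f z] by the two
    remainders only. *)
Lemma analytic_has_ps_lt (f : C -> C) (rho : R) :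
  analytic_disk f -> analytic_disk (Cderiv f) -> rho < 1 ->
  has_ps rho f (fourier rho (fun t => f (circ rho t))).
Proof.
  intros Hf Hf' Hr z Hz. assert (Hz0 := Cmod_ge_0 z). assert (HP := PI_RGT_0).
  set (g := fun t => f (circ rho t)).
  assert (Hg : forall t, Ccont g t).
  { intros t. apply (Ccont_comp f (circ rho) t (Cderiv f (circ rho t))).
    - apply Cderiv_correct; [exact Hf|]. unfold in_disk. rewrite Cmod_circ; lra.
    - apply (Ccont_circ rho (fun t => t)), continuous_id. }
  assert (Hc : forall t, Ccont (fun _ : R => f z) t) by (intros t; apply Ccont_const).
  set (S0 := fun N => sum_n (G := C_NormedModule) (fun n => fourier rho g n * Cpow z n)%C N : C).
  assert (Hz1 : forall N,
    sum_n (G := C_NormedModule) (fun n => fourier rho (fun _ => f z) n * Cpow z n)%C N = f z).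
  { induction N as [|N IH].
    - rewrite sum_O, fourier_const by lra. simpl. ring.
    - rewrite sum_Sn, IH, fourier_const by lra. change (f z + 0 * Cpow z (S N) = f z)%C. ring. }
  set (K := rho / (rho - Cmod z) * (RInt (fun t => Cmod (g t)) 0 (2 * PI)
      + RInt (fun _ => Cmod (f z)) 0 (2 * PI))).
  assert (HK : forall k N, Cmod k <= 1 ->
    2 * PI * Rabs (Re (k * (S0 N - f z))) <= (Cmod z / rho) ^ S N * K).
  { intros k N Hk.
    assert (H1 := cauchy_kernel_expansion rho z g k N Hz Hg Hk).
    assert (H2 := cauchy_kernel_expansion rho z (fun _ => f z) k N Hz Hc Hk).
    assert (H3 := cauchy_integral f Hf Hf' rho z k Hr Hz).
    rewrite Hz1 in H2. fold (S0 N) in H1. unfold g at 1 in H1. rewrite H3 in H1. clear H3.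
    replace (k * (S0 N - f z))%C with (k * S0 N - k * f z)%C by ring. rewrite re_minus.
    unfold K.
    set (J := RInt (fun t => Re (k * (circ rho t * / (circ rho t - z)) * f z)) 0 (2 * PI)) in *.
    set (I1 := RInt (fun t => Cmod (g t)) 0 (2 * PI)) in *.
    set (I2 := RInt (fun _ => Cmod (f z)) 0 (2 * PI)) in *.
    rewrite <- (Rabs_pos_eq (2 * PI)) at 1 by lra. rewrite <- Rabs_mult.
    replace (2 * PI * (Re (k * S0 N) - Re (k * f z)))
      with ((J - 2 * PI * Re (k * f z)) - (J - 2 * PI * Re (k * S0 N))) by ring.
    eapply Rle_trans; [apply Rabs_triang|]. rewrite Rabs_Ropp. lra. }
  apply is_series_C_iff.
  apply is_lim_seq_le_le with (fun _ => 0) (fun N => / PI * K * (Cmod z / rho) ^ S N).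
  - intros N. split; [apply Cmod_ge_0|].
    change (Cmod (S0 N - f z) <= / PI * K * (Cmod z / rho) ^ S N).
    assert (H1 := HK 1%C N ltac:(rewrite Cmod_1; lra)).
    assert (H2 := HK (- Ci)%C N ltac:(rewrite Cmod_opp, Cmod_Ci; lra)).
    rewrite Cmult_1_l in H1.
    replace (Re (- Ci * (S0 N - f z))) with (Im (S0 N - f z)) in H2
      by (unfold Ci, Cmult, Copp, Re, Im; simpl; ring).
    eapply Rle_trans; [apply Cmod_le_Re_Im|].
    apply Rmult_le_reg_l with (2 * PI); [lra|].
    replace (2 * PI * (/ PI * K * (Cmod z / rho) ^ S N)) with (2 * ((Cmod z / rho) ^ S N * K)) by (field; lra).
    lra.
  - apply is_lim_seq_const.
  - replace (Finite 0) with (Rbar_mult (/ PI * K) 0) by (simpl; f_equal; ring).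
    apply is_lim_seq_scal_l. apply (is_lim_seq_incr_1 (fun N => (Cmod z / rho) ^ N)).
    apply is_lim_seq_geom. rewrite Rabs_pos_eq; [apply Rlt_div_l; lra|apply Rdiv_le_0_compat; lra].
Qed.

Lemma has_ps_sub (r1 r2 : R) (f : C -> C) (c : nat -> C) :
  r1 <= r2 -> has_ps r2 f c -> has_ps r1 f c.
Proof. intros H Hf z Hz. apply Hf. lra. Qed.

(** The Fourier coefficients depend a priori on the radius. Uniqueness on the disk of radius 1/2
    identifies those of every larger circle with those of the circle of radius 1/2. *)
Lemma analytic_has_ps (f : C -> C) :
  analytic_disk f -> analytic_disk (Cderiv f) -> exists c, has_ps 1 f c.
Proof.
  intros Hf Hf'. exists (fourier (1 / 2) (fun t => f (circ (1 / 2) t))). intros z Hz.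
  assert (Hz0 := Cmod_ge_0 z).
  set (rho := Rmax (3 / 4) ((1 + Cmod z) / 2)).
  assert (H1 : 3 / 4 <= rho) by apply Rmax_l.
  assert (H2 : (1 + Cmod z) / 2 <= rho) by apply Rmax_r.
  assert (H3 : rho < 1) by (unfold rho; apply Rmax_lub_lt; lra).
  assert (P1 := analytic_has_ps_lt f (1 / 2) Hf Hf' ltac:(lra)).
  assert (P2 := analytic_has_ps_lt f rho Hf Hf' H3).
  apply is_series_ext with (2 := P2 z ltac:(lra)). intros n. f_equal.
  apply (has_ps_unique (1 / 2) f); [lra| |exact P1].
  apply has_ps_sub with (2 := P2). lra.
Qed.

(** * Hardy space estimates *)

Lemma rpow_pos (x q : R) : 0 < x -> rpow x q = Rpower x q.
Proof. intros H. unfold rpow. destruct (Rle_dec x 0); [lra|reflexivity]. Qed.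

Lemma rpow_0 (q : R) : rpow 0 q = 0.
Proof. unfold rpow. destruct (Rle_dec 0 0); [reflexivity|lra]. Qed.

Lemma rpow_ge_0 (x q : R) : 0 <= rpow x q.
Proof. unfold rpow. destruct (Rle_dec x 0); [lra|left; apply exp_pos]. Qed.

Lemma rpow_le (x y q : R) : 0 < q -> x <= y -> rpow x q <= rpow y q.
Proof.
  intros Hq H. unfold rpow at 1. destruct (Rle_dec x 0); [apply rpow_ge_0|].
  rewrite rpow_pos by lra. apply Rle_Rpower_l; lra.
Qed.

Lemma rpow_mult (x y q : R) : 0 <= x -> 0 <= y -> rpow (x * y) q = rpow x q * rpow y q.
Proof.
  intros [Hx|<-] [Hy|<-]; rewrite ?Rmult_0_l, ?Rmult_0_r, ?rpow_0; try ring.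
  rewrite !rpow_pos by nra. symmetry. apply Rpower_mult_distr; assumption.
Qed.

Lemma rpow_rpow_cancel (x p q : R) : p * q = 1 -> 0 <= x -> rpow (rpow x p) q = x.
Proof.
  intros H [Hx|<-]; [|rewrite !rpow_0; reflexivity].
  rewrite (rpow_pos x) by assumption. rewrite rpow_pos by apply exp_pos.
  rewrite Rpower_mult, H. apply Rpower_1, Hx.
Qed.

Lemma continuous_rpow (x p : R) : 0 < p -> 0 <= x -> continuous (fun y => rpow y p) x.
Proof.
  intros Hp [Hx|<-].
  - apply continuous_ext_loc with (fun y => exp (p * ln y)).
    + exists (mkposreal x Hx). intros y Hy. change (Rabs (y - x) < x) in Hy.
      apply Rabs_def2 in Hy. rewrite rpow_pos by lra. reflexivity.
    + apply (ex_derive_continuous (V := R_NormedModule)). auto_derive. exact Hx.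
  - intros P [eps HP]. assert (He := cond_pos eps).
    assert (Hd : 0 < rpow (eps / 2) (/ p)) by (rewrite rpow_pos by lra; apply exp_pos).
    exists (mkposreal _ Hd). intros y Hy. apply HP.
    change (Rabs (y - 0) < rpow (eps / 2) (/ p)) in Hy.
    change (Rabs (rpow y p - rpow 0 p) < eps).
    rewrite rpow_0, Rminus_0_r, Rabs_pos_eq by apply rpow_ge_0. rewrite Rminus_0_r in Hy.
    apply Rle_lt_trans with (eps / 2); [|lra].
    rewrite <- (rpow_rpow_cancel (eps / 2) (/ p) p) by (try field; lra).
    apply rpow_le; [exact Hp|]. generalize (Rle_abs y); lra.
Qed.

Lemma circ_in_disk (r t : R) : 0 < r < 1 -> in_disk (circ r t).
Proof. intros Hr. unfold in_disk. rewrite Cmod_circ; lra. Qed.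

Lemma Ccont_analytic_circ (g : C -> C) (r t : R) :
  analytic_disk g -> 0 < r < 1 -> Ccont (fun t => g (circ r t)) t.
Proof.
  intros Hg Hr. apply (Ccont_comp g (circ r) t (Cderiv g (circ r t))).
  - apply Cderiv_correct; [exact Hg|apply circ_in_disk, Hr].
  - apply (Ccont_circ r (fun t => t)), continuous_id.
Qed.

Lemma Mp_is_RInt (p : R) (g : C -> C) (r : R) :
  0 < p -> analytic_disk g -> 0 < r < 1 ->
  is_RInt (fun t => rpow (Cmod (g (circ r t))) p) 0 (2 * PI) (2 * PI * Mp p g r).
Proof.
  intros Hp Hg Hr.
  assert (H : forall t, continuous (fun t => rpow (Cmod (g (circ r t))) p) t).
  { intros t. apply (continuous_comp (fun t => Cmod (g (circ r t))) (fun y => rpow y p)).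
    - apply continuous_Cmod, Ccont_analytic_circ; assumption.
    - apply continuous_rpow; [exact Hp|apply Cmod_ge_0]. }
  assert (E : 2 * PI * Mp p g r = RInt (fun t => rpow (Cmod (g (circ r t))) p) 0 (2 * PI)).
  { unfold Mp. rewrite <- Rmult_assoc, Rinv_r, Rmult_1_l; [reflexivity|].
    generalize PI_RGT_0; lra. }
  rewrite E. apply (RInt_correct (V := R_CompleteNormedModule)), ex_RInt_continuous_R, H.
Qed.

Lemma is_RInt_const_2PI (c : R) : is_RInt (fun _ => c) 0 (2 * PI) (2 * PI * c).
Proof.
  replace (2 * PI * c) with (scal (2 * PI - 0) c) by (unfold scal; simpl; unfold mult; simpl; ring).
  apply (is_RInt_const (V := R_NormedModule)).
Qed.

(** A sum is at most twice its larger term. This takes the place of Minkowski's inequality, at the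
    price of the factor 2^p. *)
Lemma rpow_affine_le (p B L x : R) :
  0 < p -> 0 <= B -> 0 <= L -> 0 <= x ->
  rpow (B + L * x) p <= rpow 2 p * (rpow B p + rpow L p * rpow x p).
Proof.
  intros Hp HB HL Hx. rewrite <- rpow_mult by assumption.
  assert (HLx : 0 <= L * x) by (apply Rmult_le_pos; assumption).
  assert (P1 := rpow_ge_0 B p). assert (P2 := rpow_ge_0 (L * x) p). assert (P3 := rpow_ge_0 2 p).
  destruct (Rle_lt_dec B (L * x)).
  - apply Rle_trans with (rpow (2 * (L * x)) p); [apply rpow_le; lra|].
    rewrite rpow_mult by lra. apply Rmult_le_compat_l; lra.
  - apply Rle_trans with (rpow (2 * B) p); [apply rpow_le; lra|].
    rewrite rpow_mult by lra. apply Rmult_le_compat_l; lra.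
Qed.

Lemma Mp_affine_le (p : R) (g k : C -> C) (r B L : R) :
  0 < p -> analytic_disk g -> analytic_disk k -> 0 < r < 1 -> 0 <= B -> 0 <= L ->
  (forall z, in_disk z -> Cmod (k z) <= B + L * Cmod (g z)) ->
  Mp p k r <= rpow 2 p * (rpow B p + rpow L p * Mp p g r).
Proof.
  intros Hp Hg Hk Hr HB HL H. assert (HP := two_PI_pos).
  assert (H1 := is_RInt_scal _ _ _ (rpow L p) _ (Mp_is_RInt p g r Hp Hg Hr)).
  assert (H2 := is_RInt_scal _ _ _ (rpow 2 p) _ (is_RInt_plus _ _ _ _ _ _ (is_RInt_const_2PI (rpow B p)) H1)).
  apply Rmult_le_reg_l with (2 * PI); [exact HP|].
  replace (2 * PI * (rpow 2 p * (rpow B p + rpow L p * Mp p g r)))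
    with (rpow 2 p * (2 * PI * rpow B p + rpow L p * (2 * PI * Mp p g r))) by ring.
  refine (is_RInt_le _ _ _ _ _ _ (Rlt_le _ _ HP) (Mp_is_RInt p k r Hp Hk Hr) H2 _).
  intros t _.
  change (rpow (Cmod (k (circ r t))) p
    <= rpow 2 p * (rpow B p + rpow L p * rpow (Cmod (g (circ r t))) p)).
  eapply Rle_trans; [|apply rpow_affine_le; try assumption; apply Cmod_ge_0].
  apply rpow_le; [exact Hp|]. apply H, circ_in_disk, Hr.
Qed.

Lemma Mp_ge_0 (p : R) (g : C -> C) (r : R) :
  0 < p -> analytic_disk g -> 0 < r < 1 -> 0 <= Mp p g r.
Proof.
  intros Hp Hg Hr. assert (HP := two_PI_pos).
  assert (H := is_RInt_le _ _ _ _ _ _ (Rlt_le _ _ HP) (is_RInt_const_2PI 0) (Mp_is_RInt p g r Hp Hg Hr)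
    (fun t _ => rpow_ge_0 _ _)).
  rewrite Rmult_0_r in H. apply Rmult_le_reg_l with (2 * PI); [exact HP|]. lra.
Qed.

Lemma Hp_norm_ge_0 (p : R) (g : C -> C) : 0 <= Hp_norm p g.
Proof. apply rpow_ge_0. Qed.

Lemma Mp_le_Hp_norm (p : R) (g : C -> C) (r : R) :
  0 < p -> in_Hp p g -> 0 < r < 1 -> Mp p g r <= rpow (Hp_norm p g) p.
Proof.
  intros Hp [Hg [K HK]] Hr. unfold Hp_norm.
  set (E := fun x => exists r0, 0 < r0 < 1 /\ x = Mp p g r0).
  destruct (Lub_Rbar_correct E) as [U1 U2].
  assert (HE : E (Mp p g r)) by (exists r; split; [exact Hr|reflexivity]).
  assert (V1 := U1 _ HE).
  (* [real] sends infinite values to 0, so the supremum must be shown finite before it can serve as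
     a bound. *)
  assert (V2 : Rbar_le (Lub_Rbar E) K).
  { apply U2. intros x [r0 [Hr0 ->]]. apply HK, Hr0. }
  destruct (Lub_Rbar E) as [l| |]; try contradiction. simpl in V1 |- *.
  rewrite rpow_rpow_cancel; [exact V1|field; lra|].
  apply Rle_trans with (2 := V1). apply Mp_ge_0; assumption.
Qed.

Lemma Hp_norm_le (p N : R) (g : C -> C) :
  0 < p -> 0 <= N -> (forall r, 0 < r < 1 -> Mp p g r <= rpow N p) -> Hp_norm p g <= N.
Proof.
  intros Hp HN H. unfold Hp_norm.
  set (E := fun x => exists r0, 0 < r0 < 1 /\ x = Mp p g r0).
  destruct (Lub_Rbar_correct E) as [U1 U2].
  assert (V2 : Rbar_le (Lub_Rbar E) (rpow N p)).
  { apply U2. intros x [r0 [Hr0 ->]]. apply H, Hr0. }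
  rewrite <- (rpow_rpow_cancel N p (/ p)) by (try field; lra).
  apply rpow_le; [apply Rinv_0_lt_compat, Hp|].
  (* The remaining case is a supremum of minus infinity, where [real] returns 0. *)
  destruct (Lub_Rbar E) as [l| |]; simpl in V2 |- *; try contradiction; try exact V2. apply rpow_ge_0.
Qed.

(* Substitute for Hoelder's inequality: integrating with s the L^p norm bounds the L^1 norm
   by twice the L^p norm. *)
Lemma Rle_rpow_split (p x s : R) :
  1 < p -> 0 <= x -> 0 < s -> x <= s + rpow x p * Rpower s (1 - p).
Proof.
  intros Hp Hx Hs. assert (P := rpow_ge_0 x p).
  assert (Q : 0 < Rpower s (1 - p)) by apply exp_pos.
  destruct (Rle_lt_dec x s) as [H|H]; [nra|].
  rewrite rpow_pos by lra.
  replace p with (1 + (p - 1)) at 1 by ring. rewrite Rpower_plus, Rpower_1 by lra.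
  assert (E : Rpower s (1 - p) = / Rpower s (p - 1)).
  { rewrite <- Rpower_Ropp. f_equal. ring. }
  rewrite E. assert (P1 : 0 < Rpower s (p - 1)) by apply exp_pos.
  assert (P2 : Rpower s (p - 1) <= Rpower x (p - 1)) by (apply Rle_Rpower_l; lra).
  assert (P3 : 1 <= Rpower x (p - 1) * / Rpower s (p - 1)).
  { apply Rmult_le_reg_r with (Rpower s (p - 1)); [exact P1|].
    rewrite Rmult_assoc, Rinv_l, Rmult_1_l, Rmult_1_r; lra. }
  rewrite Rmult_assoc. nra.
Qed.

Lemma Hp_mean_le (p : R) (g : C -> C) (r : R) :
  1 < p -> in_Hp p g -> 0 < r < 1 ->
  RInt (fun t => Cmod (g (circ r t))) 0 (2 * PI) <= 2 * PI * (2 * Hp_norm p g).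
Proof.
  intros Hp Hin Hr. assert (HP := two_PI_pos). assert (Hp0 : 0 < p) by lra.
  assert (HN := Hp_norm_ge_0 p g). assert (HM := Mp_le_Hp_norm p g r Hp0 Hin Hr).
  destruct Hin as [Hg _].
  assert (HI : is_RInt (fun t => Cmod (g (circ r t))) 0 (2 * PI) (RInt (fun t => Cmod (g (circ r t))) 0 (2 * PI))).
  { apply (RInt_correct (V := R_CompleteNormedModule)), ex_RInt_continuous_R.
    intros t. apply continuous_Cmod, Ccont_analytic_circ; assumption. }
  set (I := RInt _ _ _) in *. set (N := Hp_norm p g) in *.
  (* Strict inequality keeps s positive even if the norm is 0. Integrating the pointwise split gives
     the mean bound s + s^(1-p) s^p = 2 s; afterwards s decreases to the norm. *)
  assert (HS : forall s, N < s -> I <= 2 * PI * (2 * s)).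
  { intros s Hs. assert (Hs0 : 0 < s) by lra.
    assert (J := is_RInt_plus _ _ _ _ _ _ (is_RInt_const_2PI s)
      (is_RInt_scal _ _ _ (Rpower s (1 - p)) _ (Mp_is_RInt p g r Hp0 Hg Hr))).
    assert (T : I <= 2 * PI * s + Rpower s (1 - p) * (2 * PI * Mp p g r)).
    { refine (is_RInt_le _ _ _ _ _ _ (Rlt_le _ _ HP) HI J _). intros t _.
      change (Cmod (g (circ r t)) <= s + Rpower s (1 - p) * rpow (Cmod (g (circ r t))) p).
      rewrite (Rmult_comm (Rpower s _)). apply Rle_rpow_split; [exact Hp|apply Cmod_ge_0|exact Hs0]. }
    assert (Q : 0 < Rpower s (1 - p)) by apply exp_pos.
    assert (M1 : Mp p g r <= Rpower s p).
    { rewrite <- rpow_pos by exact Hs0. eapply Rle_trans; [exact HM|]. apply rpow_le; lra. }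
    assert (M2 : Rpower s (1 - p) * Rpower s p = s).
    { rewrite <- Rpower_plus. replace (1 - p + p) with 1 by ring. apply Rpower_1, Hs0. }
    apply Rle_trans with (1 := T).
    replace (2 * PI * (2 * s)) with (2 * PI * s + 2 * PI * s) by ring.
    apply Rplus_le_compat_l. rewrite <- M2 at 2.
    replace (Rpower s (1 - p) * (2 * PI * Mp p g r)) with (2 * PI * (Rpower s (1 - p) * Mp p g r)) by ring.
    apply Rmult_le_compat_l; [lra|]. apply Rmult_le_compat_l; lra. }
  apply le_epsilon. intros eps Heps.
  set (d := eps / (2 * (2 * PI))).
  assert (Hd : 0 < d) by (apply Rdiv_lt_0_compat; lra).
  assert (T := HS (N + d) ltac:(lra)).
  replace (2 * PI * (2 * (N + d))) with (2 * PI * (2 * N) + eps) in T; [exact T|].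
  unfold d. field. generalize PI_RGT_0; lra.
Qed.

(** The limit r -> 1, made quantitative by Bernoulli's inequality 1 - n (1 - r) <= r^n. *)
Lemma Rle_of_mult_pow (x y : R) (n : nat) :
  0 <= x -> (forall r, 0 < r < 1 -> x * r ^ n <= y) -> x <= y.
Proof.
  intros Hx H.
  assert (B : forall r, 0 < r < 1 -> 1 - INR n * (1 - r) <= r ^ n).
  { intros r Hr. clear H. induction n as [|n IH]; [simpl; lra|].
    rewrite S_INR. simpl pow.
    assert (P1 : 0 <= r ^ n) by (apply pow_le; lra).
    assert (P2 : r ^ n <= 1) by (rewrite <- (pow1 n); apply pow_incr; lra).
    assert (P3 := pos_INR n). nra. }
  apply le_epsilon. intros eps Heps. assert (P3 := pos_INR n).
  assert (HX : 0 < x * INR n + 1) by nra.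
  set (d := Rmin (1 / 2) (eps / (x * INR n + 1))).
  assert (Hd : 0 < d) by (apply Rmin_pos; [lra|apply Rdiv_lt_0_compat; lra]).
  assert (Hd1 : d <= 1 / 2) by apply Rmin_l.
  assert (Hd2 : d * (x * INR n + 1) <= eps).
  { apply Rle_trans with (eps / (x * INR n + 1) * (x * INR n + 1)).
    - apply Rmult_le_compat_r; [lra|apply Rmin_r].
    - apply Req_le. field. lra. }
  specialize (H (1 - d) ltac:(lra)). specialize (B (1 - d) ltac:(lra)).
  replace (1 - (1 - d)) with d in B by ring.
  apply Rmult_le_compat_l with (r := x) in B; [|exact Hx]. nra.
Qed.

Lemma Sp_norm_ge_0 (p : R) (f : C -> C) : 0 <= Sp_norm p f.
Proof. unfold Sp_norm. generalize (Cmod_ge_0 (f (0, 0))) (Hp_norm_ge_0 p (Cderiv f)); lra. Qed.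

(** For positive index, |c_(n+1)| <= (n+1) |c_(n+1)|, a coefficient of f', which is bounded by
    circular means of |f'| and thus by twice the Hardy norm. The coefficient of index 0 is f(0). *)
Lemma Sp_coef_le (p : R) (f : C -> C) (c : nat -> C) (n : nat) :
  1 < p -> in_Sp p f -> has_ps 1 f c -> Cmod (c n) <= 2 * Sp_norm p f.
Proof.
  intros Hp [_ Hf] Hc. unfold Sp_norm.
  assert (P1 := Cmod_ge_0 (f (0, 0))). assert (P2 := Hp_norm_ge_0 p (Cderiv f)).
  destruct n as [|n].
  - rewrite <- (has_ps_at_0 1 f c Rlt_0_1 Hc). change (RtoC 0) with (0, 0). lra.
  - assert (HD := has_ps_Cderiv 1 f c Hc). assert (HP := two_PI_pos).
    apply Rle_trans with (Cmod (dcoef c n)).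
    + unfold dcoef. rewrite Cmod_mult, Cmod_R, Rabs_pos_eq by apply pos_INR.
      assert (P3 := Cmod_ge_0 (c (S n))). rewrite S_INR. assert (P4 := pos_INR n). nra.
    + apply Rle_trans with (2 * Hp_norm p (Cderiv f)); [|lra].
      apply Rle_of_mult_pow with n; [apply Cmod_ge_0|]. intros r Hr.
      apply Rmult_le_reg_l with (2 * PI); [exact HP|].
      eapply Rle_trans; [apply (has_ps_coef_le 1 r _ _ n HD Hr)|].
      apply Hp_mean_le; assumption.
Qed.

Lemma in_Sp_has_ps (p : R) (f : C -> C) : in_Sp p f -> exists c, has_ps 1 f c.
Proof. intros [Hf [Hf' _]]. apply analytic_has_ps; assumption. Qed.

(** The series of k' - L f' has coefficients (m+1)(d_(m+1) - L c_(m+1)), so its modulus on the disk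
    is at most B times the sum of (m+1) E_(m+1). The constant [K] is uniform in the functions, which
    is what operator bounds require. *)
Lemma Sp_dominated (p : R) (L : C) (E : nat -> R) :
  1 < p -> (forall m, 0 <= E m) -> ex_series (fun m => INR (S m) * E (S m)) ->
  exists K, 0 <= K /\ forall f k c d B, 0 <= B -> in_Sp p f -> has_ps 1 f c -> has_ps 1 k d ->
    (forall m, Cmod (d m - L * c m) <= B * E m) ->
    in_Sp p k /\ Sp_norm p k <= K * (Sp_norm p f + B).
Proof.
  intros Hp HE [sE HS]. assert (Hp0 : 0 < p) by lra.
  assert (HL := Cmod_ge_0 L).
  assert (HS0 : 0 <= sE).
  { apply (is_lim_seq_le (fun _ => 0) (sum_n (fun m => INR (S m) * E (S m))) 0 sE).
    - intros n. induction n as [|n IH].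
      + rewrite sum_O. apply Rmult_le_pos; [apply pos_INR|apply HE].
      + rewrite sum_Sn. apply Rplus_le_le_0_compat; [exact IH|].
        apply Rmult_le_pos; [apply pos_INR|apply HE].
    - apply is_lim_seq_const.
    - exact HS. }
  (* The value at 0 contributes |L| + E_0, the norm of the derivative 4 |L| + 4 [sE]. *)
  exists (5 * Cmod L + E O + 4 * sE). split; [generalize (HE O); lra|].
  intros f k c d B HB Hf Hc Hd HdE.
  assert (Hc' := has_ps_Cderiv _ _ _ Hc). assert (Hd' := has_ps_Cderiv _ _ _ Hd).
  assert (HD : has_ps 1 (fun z => Cderiv k z - L * Cderiv f z)%C (fun n => dcoef d n - L * dcoef c n)%C).
  { apply has_ps_minus; [exact Hd'|]. apply has_ps_scal, Hc'. }
  assert (Hbound : forall z, in_disk z -> Cmod (Cderiv k z) <= B * sE + Cmod L * Cmod (Cderiv f z)).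
  { intros z Hz.
    assert (T : Cmod (Cderiv k z - L * Cderiv f z) <= B * sE).
    { apply (Cmod_is_series_le _ _ _ _ (HD z Hz) (is_series_scal (V := R_NormedModule) B _ _ HS)).
      intros n. change (Cmod ((dcoef d n - L * dcoef c n) * Cpow z n)
        <= B * (INR (S n) * E (S n))).
      rewrite Cmod_mult, Cmod_pow.
      replace (dcoef d n - L * dcoef c n)%C
        with (RtoC (INR (S n)) * (d (S n) - L * c (S n)))%C
        by (unfold dcoef; ring).
      rewrite Cmod_mult, Cmod_R, Rabs_pos_eq by apply pos_INR.
      apply Rle_trans with (INR (S n) * Cmod (d (S n) - L * c (S n)) * 1).
      - apply Rmult_le_compat_l.
        + apply Rmult_le_pos; [apply pos_INR|apply Cmod_ge_0].
        + rewrite <- (pow1 n). apply pow_incr. split; [apply Cmod_ge_0|apply Rlt_le, Hz].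
      - rewrite Rmult_1_r.
        replace (B * (INR (S n) * E (S n)))
          with (INR (S n) * (B * E (S n))) by ring.
        apply Rmult_le_compat_l; [apply pos_INR|apply HdE]. }
    replace (Cderiv k z) with (Cderiv k z - L * Cderiv f z + L * Cderiv f z)%C by ring.
    eapply Rle_trans; [apply Cmod_triangle|]. rewrite Cmod_mult. lra. }
  assert (Hk' := has_ps_analytic _ _ Hd').
  set (N := Hp_norm p (Cderiv f)). assert (HN : 0 <= N) by apply Hp_norm_ge_0.
  assert (HBS : 0 <= B * sE) by (apply Rmult_le_pos; assumption).
  assert (HLN : 0 <= Cmod L * N) by (apply Rmult_le_pos; assumption).
  set (W := B * sE + Cmod L * N).
  (* One factor 2 comes from the affine estimate; the other absorbs the sum of two terms, each at
     most W^p, through 2 <= 2^p. *)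
  assert (HM : forall r, 0 < r < 1 -> Mp p (Cderiv k) r <= rpow (4 * W) p).
  { intros r Hr.
    eapply Rle_trans; [apply (Mp_affine_le p (Cderiv f) (Cderiv k) r (B * sE) (Cmod L) Hp0
      (proj1 (proj2 Hf)) Hk' Hr HBS HL Hbound)|].
    replace 4 with (2 * 2) by ring. rewrite Rmult_assoc.
    rewrite (rpow_mult 2 (2 * W)) by (unfold W; lra). apply Rmult_le_compat_l; [apply rpow_ge_0|].
    rewrite (rpow_mult 2 W) by (unfold W; lra).
    assert (H2 : 2 <= rpow 2 p).
    { rewrite rpow_pos by lra. rewrite <- (Rpower_1 2) at 1 by lra. apply Rle_Rpower; lra. }
    assert (H3 : rpow (B * sE) p <= rpow W p) by (apply rpow_le; unfold W; lra).
    assert (H4 : rpow (Cmod L) p * Mp p (Cderiv f) r <= rpow W p).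
    { apply Rle_trans with (rpow (Cmod L * N) p); [|apply rpow_le; unfold W; lra].
      rewrite rpow_mult by assumption. apply Rmult_le_compat_l; [apply rpow_ge_0|].
      apply Mp_le_Hp_norm; [exact Hp0|apply Hf|exact Hr]. }
    assert (H5 := rpow_ge_0 W p). nra. }
  split.
  - split; [exact (has_ps_analytic _ _ Hd)|]. split; [exact Hk'|]. eexists. exact HM.
  - assert (HkN : Hp_norm p (Cderiv k) <= 4 * W).
    { apply Hp_norm_le; [exact Hp0|unfold W; lra|exact HM]. }
    unfold Sp_norm. fold N.
    assert (K0 : Cmod (k (0, 0)) <= Cmod L * Cmod (f (0, 0)) + B * E O).
    { change (0, 0) with (RtoC 0).
      rewrite (has_ps_at_0 1 k d Rlt_0_1 Hd), (has_ps_at_0 1 f c Rlt_0_1 Hc).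
      replace (d O) with (d O - L * c O + L * c O)%C by ring.
      eapply Rle_trans; [apply Cmod_triangle|]. rewrite Cmod_mult. specialize (HdE O). lra. }
    assert (F0 := Cmod_ge_0 (f (0, 0))). assert (E0 := HE O).
    unfold W in HkN. set (F := Cmod (f (0, 0))) in *.
    assert (0 <= Cmod L * F) by (apply Rmult_le_pos; assumption).
    assert (0 <= E O * F) by (apply Rmult_le_pos; assumption).
    assert (0 <= sE * F) by (apply Rmult_le_pos; assumption).
    assert (0 <= E O * N) by (apply Rmult_le_pos; assumption).
    assert (0 <= sE * N) by (apply Rmult_le_pos; assumption).
    assert (0 <= Cmod L * B) by (apply Rmult_le_pos; assumption).
    nra.
Qed.

(** * Weighted shifts on bounded sequences *)

Section WeightedShift.
Variables (tau kap : nat -> nat) (v : nat -> C) (delta : R) (kmax : nat).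
Hypothesis Hdelta : 0 < delta <= 1.
Hypothesis Hkap : forall m, (kap m <= kmax)%nat.
Hypothesis Hv : forall m, delta ^ kap m * Cmod (v m) <= / 2 * delta ^ kap (tau m).

(** In the supremum norm with these weights, c |-> (v m * c (tau m)) has norm at most 1/2 by [Hv].
    As [kap] is bounded, this norm is equivalent to the ordinary one. *)
Let weight (m : nat) : R := delta ^ kap m.

Lemma weight_bounds (m : nat) : 0 < delta ^ kmax <= weight m /\ weight m <= 1.
Proof.
  assert (P : forall n, 0 < delta ^ n <= 1).
  { induction n as [|n IH]; simpl; nra. }
  unfold weight. repeat split; try apply P.
  replace kmax with (kap m + (kmax - kap m))%nat by (specialize (Hkap m); lia).
  rewrite pow_add. assert (P1 := P (kap m)). assert (P2 := P (kmax - kap m)%nat). nra.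
Qed.

(** Iterating the equation j times gives 2 B + A / 2^j, where 2 B is the fixed point of x |-> B +
    x/2. In the limit the a priori bound [A] disappears, so the estimate depends on [u] alone. *)
Lemma weighted_shift_bound (c u : nat -> C) (A B : R) :
  (forall m, Cmod (c m) <= A) -> (forall m, Cmod (u m) <= B) ->
  (forall m, c m = u m + v m * c (tau m))%C ->
  forall m, Cmod (c m) <= 2 * B / delta ^ kmax.
Proof.
  intros HA HB Hc.
  assert (HB0 : 0 <= B) by (apply Rle_trans with (2 := HB O), Cmod_ge_0).
  assert (P : forall j m, weight m * Cmod (c m) <= 2 * B + A * (/ 2) ^ j).
  { induction j as [|j IH]; intros m;
      destruct (weight_bounds m) as [W1 W2]; assert (C0 := Cmod_ge_0 (c m)).
    - simpl. specialize (HA m). nra.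
    - rewrite Hc. apply Rle_trans with (weight m * (Cmod (u m) + Cmod (v m) * Cmod (c (tau m)))).
      + apply Rmult_le_compat_l; [lra|]. eapply Rle_trans; [apply Cmod_triangle|].
        rewrite Cmod_mult. lra.
      + specialize (HB m). specialize (IH (tau m)). specialize (Hv m).
        assert (U0 := Cmod_ge_0 (u m)). assert (C1 := Cmod_ge_0 (c (tau m))).
        assert (X : weight m * Cmod (v m) * Cmod (c (tau m)) <= / 2 * weight (tau m) * Cmod (c (tau m))).
        { apply Rmult_le_compat_r; assumption. }
        simpl pow. nra. }
  assert (Q : forall m, weight m * Cmod (c m) <= 2 * B).
  { intros m. apply (is_lim_seq_le (fun _ => weight m * Cmod (c m)) (fun j => 2 * B + A * (/ 2) ^ j)
      (weight m * Cmod (c m)) (2 * B)).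
    - intros j. apply P.
    - apply is_lim_seq_const.
    - replace (Finite (2 * B)) with (Finite (2 * B + A * 0)) by (f_equal; ring).
      apply is_lim_seq_plus'; [apply is_lim_seq_const|].
      apply (is_lim_seq_scal_l _ A 0). apply is_lim_seq_geom. rewrite Rabs_pos_eq; lra. }
  intros m. destruct (weight_bounds m) as [W1 W2]. specialize (Q m). assert (C0 := Cmod_ge_0 (c m)).
  apply Rle_div_r; [apply W1|]. nra.
Qed.

(** The k-th term of the Neumann series: the k-th power of the weighted shift applied to [u]. *)
Fixpoint shift_iter (u : nat -> C) (k m : nat) : C :=
  match k with
  | O => u m
  | S k => (v m * shift_iter u k (tau m))%C
  end.

(** The Neumann series converges geometrically at each index; splitting off its first term [u m] and
    factoring [v m] out of the rest is the equation itself. *)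
Lemma weighted_shift_solution (u : nat -> C) (B : R) :
  (forall m, Cmod (u m) <= B) ->
  exists c, (exists A, forall m, Cmod (c m) <= A) /\
    (forall m, c m = u m + v m * c (tau m))%C.
Proof.
  intros HB. assert (HB0 : 0 <= B) by (apply Rle_trans with (2 := HB O), Cmod_ge_0).
  assert (P : forall k m, weight m * Cmod (shift_iter u k m) <= B * (/ 2) ^ k).
  { induction k as [|k IH]; intros m; destruct (weight_bounds m) as [W1 W2].
    - simpl. specialize (HB m). assert (U0 := Cmod_ge_0 (u m)). nra.
    - simpl. rewrite Cmod_mult. specialize (IH (tau m)). specialize (Hv m).
      assert (C1 := Cmod_ge_0 (shift_iter u k (tau m))).
      assert (X : weight m * Cmod (v m) * Cmod (shift_iter u k (tau m))
        <= / 2 * weight (tau m) * Cmod (shift_iter u k (tau m))).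
      { apply Rmult_le_compat_r; assumption. }
      nra. }
  assert (Q : forall k m, Cmod (shift_iter u k m) <= B / delta ^ kmax * (/ 2) ^ k).
  { intros k m. destruct (weight_bounds m) as [W1 W2]. specialize (P k m).
    assert (C1 := Cmod_ge_0 (shift_iter u k m)).
    apply Rmult_le_reg_l with (delta ^ kmax); [apply W1|].
    replace (delta ^ kmax * (B / delta ^ kmax * (/ 2) ^ k)) with (B * (/ 2) ^ k) by (field; lra).
    nra. }
  assert (HG : is_series (fun k => B / delta ^ kmax * (/ 2) ^ k) (B / delta ^ kmax * / (1 - / 2))).
  { apply (is_series_scal (V := R_NormedModule)), is_series_geom. rewrite Rabs_pos_eq; lra. }
  set (c := fun m => epsilon (inhabits (RtoC 0))
    (fun l => is_series (V := C_NormedModule) (fun k => shift_iter u k m) l)).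
  assert (Hc : forall m, is_series (V := C_NormedModule) (fun k => shift_iter u k m) (c m)).
  { intros m. apply epsilon_spec.
    apply ex_series_C_le with (fun k => B / delta ^ kmax * (/ 2) ^ k).
    - intros k; apply Q.
    - eexists; exact HG. }
  exists c. split.
  - exists (B / delta ^ kmax * / (1 - / 2)). intros m.
    apply (Cmod_is_series_le _ _ _ _ (Hc m) HG). intros k; apply Q.
  - intros m. apply (is_series_C_unique _ _ _ (Hc m)).
    apply (is_series_decr_1 (V := C_NormedModule)).
    match goal with |- is_series _ ?x => replace x with (v m * c (tau m))%C end.
    + exact (is_series_scal (V := C_NormedModule) (v m) _ _ (Hc (tau m))).
    + change (v m * c (tau m) = u m + v m * c (tau m) + - u m)%C. ring.
Qed.

End WeightedShift.

(** * The coefficient shift of D_phi and its resolvent on bounded sequences *)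

Definition shift_index (M m : nat) : nat := S (m / M).

Definition shift_coef (a : C) (M m : nat) : C :=
  if Nat.eqb (m mod M) 0 then (RtoC (INR (S (m / M))) * Cpow a (m / M))%C else RtoC 0.

Lemma shift_coef_2_2 (a : C) : shift_coef a 2 2 = (2 * a)%C.
Proof.
  change (RtoC (1 + 1) * Cpow a 1 = 2 * a)%C. rewrite Cpow_1_r.
  replace (1 + 1) with 2 by ring. reflexivity.
Qed.

Lemma Cmod_shift_coef_le (a : C) (M m : nat) :
  Cmod (shift_coef a M m) <= (INR (m / M) + 1) * Cmod a ^ (m / M).
Proof.
  assert (H : 0 <= (INR (m / M) + 1) * Cmod a ^ (m / M)).
  { apply Rmult_le_pos; [generalize (pos_INR (m / M)); lra|apply pow_le, Cmod_ge_0]. }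
  unfold shift_coef. destruct (Nat.eqb (m mod M) 0).
  - rewrite Cmod_mult, Cmod_R, Cmod_pow, Rabs_pos_eq, S_INR by apply pos_INR. apply Rle_refl.
  - rewrite Cmod_0. exact H.
Qed.

Lemma is_lim_seq_linear_geom (q : R) :
  0 <= q < 1 -> is_lim_seq (fun n => (INR n + 1) * q ^ n) 0.
Proof.
  intros Hq.
  apply is_lim_seq_le_le with (fun _ => 0) (fun n => (INR n + 1) * (INR n + 2) * q ^ n).
  - intros n. assert (Hn := pos_INR n). assert (P : 0 <= q ^ n) by (apply pow_le; lra).
    split; [apply Rmult_le_pos; lra|]. apply Rmult_le_compat_r; [exact P|nra].
  - apply is_lim_seq_const.
  - exact (ex_series_lim_0 _ (ex_series_quadratic_geom q Hq)).
Qed.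

(* tau(m) = m/M + 1 increases slowly for M = 1 and decreases strictly for M >= 2, except at
   m = 0 and at the fixed point m = M = 2; kap counts how far m is from the range where
   |v m| <= 1/2. *)
Lemma shift_weights (a : C) (M : nat) (v : nat -> C) (r : R) :
  Cmod a < 1 -> (0 < M)%nat -> 0 < r ->
  (forall m, Cmod (v m) <= r * Cmod (shift_coef a M m)) ->
  (M = 2%nat -> v 2%nat = 0) ->
  exists kap delta kmax, 0 < delta <= 1 /\ (forall m, (kap m <= kmax)%nat) /\
    forall m, delta ^ kap m * Cmod (v m) <= / 2 * delta ^ kap (shift_index M m).
Proof.
  intros Ha HM Hr Hv H2.
  assert (Ha' : 0 <= Cmod a < 1) by (split; [apply Cmod_ge_0|exact Ha]).
  assert (HL := is_lim_seq_linear_geom (Cmod a) Ha').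
  destruct (filterlim_bounded (V := R_NormedModule) (fun n => (INR n + 1) * Cmod a ^ n)
    (ex_intro _ 0 HL)) as [V HV].
  assert (HV' : forall n, (INR n + 1) * Cmod a ^ n <= Rabs V).
  { intros n. eapply Rle_trans; [apply Rle_abs|]. eapply Rle_trans; [apply HV|]. apply Rle_abs. }
  apply is_lim_seq_spec in HL.
  assert (He : 0 < / (2 * r)) by (apply Rinv_0_lt_compat; lra).
  destruct (HL (mkposreal _ He)) as [n0 Hn0]. simpl in Hn0.
  assert (Hbig : exists N, forall m, (N <= m)%nat -> Cmod (v m) <= / 2).
  { exists (n0 * M)%nat. intros m Hm. assert (Hq : (n0 <= m / M)%nat) by (apply Nat.div_le_lower_bound; nia).
    specialize (Hn0 _ Hq). rewrite Rminus_0_r in Hn0. apply Rabs_def2 in Hn0.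
    eapply Rle_trans; [apply Hv|].
    apply Rle_trans with (r * / (2 * r)); [|apply Req_le; field; lra].
    apply Rmult_le_compat_l; [lra|]. eapply Rle_trans; [apply Cmod_shift_coef_le|]. lra. }
  destruct Hbig as [N Hbig].
  set (U := r * Rabs V).
  assert (HU0 : 0 <= U) by (apply Rmult_le_pos; [lra|apply Rabs_pos]).
  assert (HU : forall m, Cmod (v m) <= U).
  { intros m. eapply Rle_trans; [apply Hv|]. apply Rmult_le_compat_l; [lra|].
    eapply Rle_trans; [apply Cmod_shift_coef_le|apply HV']. }
  (* Chosen so that delta U <= 1/2: a single drop of [kap] compensates the largest possible |v
     m|. *)
  set (delta := / (2 * (U + 1))).
  assert (Hd : 0 < delta) by (apply Rinv_0_lt_compat; lra).
  assert (Hd2 : delta * (2 * (U + 1)) = 1) by (unfold delta; field; lra).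
  assert (Hd1 : delta <= 1) by nra.
  assert (HdU : delta * U <= / 2) by nra.
  assert (Hpow : forall i j, (i <= j)%nat -> 0 < delta ^ j <= delta ^ i).
  { intros i j Hij. split; [apply pow_lt, Hd|].
    replace j with (i + (j - i))%nat by lia. rewrite pow_add.
    assert (P1 : 0 < delta ^ i) by apply pow_lt, Hd.
    assert (P2 : delta ^ (j - i) <= 1) by (rewrite <- (pow1 (j - i)); apply pow_incr; lra).
    nra. }
  (* Three ways to satisfy the weight condition: the factor is 0, or [kap] drops strictly along the
     shift, or |v m| <= 1/2 already holds and [kap] does not increase. *)
  assert (Crit : forall kap : nat -> nat,
    (forall m, v m = 0 \/ (kap (shift_index M m) < kap m)%nat
      \/ ((N <= m)%nat /\ (kap (shift_index M m) <= kap m)%nat)) ->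
    forall m, delta ^ kap m * Cmod (v m) <= / 2 * delta ^ kap (shift_index M m)).
  { intros kap Hk m. assert (V0 := Cmod_ge_0 (v m)).
    assert (P0 : 0 < delta ^ kap (shift_index M m)) by apply pow_lt, Hd.
    destruct (Hk m) as [E|[E|[E1 E2]]].
    - rewrite E, Cmod_0. lra.
    - assert (P := Hpow (S (kap (shift_index M m))) (kap m) E). simpl pow in P. specialize (HU m).
      apply Rle_trans with (delta * delta ^ kap (shift_index M m) * U).
      + apply Rmult_le_compat; lra.
      + nra.
    - assert (P := Hpow _ _ E2). specialize (Hbig m E1).
      rewrite (Rmult_comm (/ 2)). apply Rmult_le_compat; lra. }
  assert (Hv0 : forall m, m mod M <> O -> v m = 0).
  { intros m Hm. apply Cmod_eq_0. apply Rle_antisym; [|apply Cmod_ge_0].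
    eapply Rle_trans; [apply Hv|]. unfold shift_coef.
    rewrite (proj2 (Nat.eqb_neq (m mod M) 0) Hm), Cmod_0. lra. }
  destruct (Nat.eq_dec M 1) as [E1|E1].
  (* For M = 1 the index goes up by one, so the distance to [N] drops until it stays at 0. *)
  - exists (fun m => (N - m)%nat), delta, N. split; [lra|]. split; [intros; lia|].
    apply Crit. intros m. right. unfold shift_index. rewrite E1, Nat.div_1_r. lia.
  (* For M >= 2 the index goes down wherever v m may be nonzero, except that 0 moves up to 1; hence
     0 receives the largest value [S N]. *)
  - exists (fun m => if Nat.eqb m 0 then S N else Nat.min m N), delta, (S N).
    split; [lra|]. split; [intros m; destruct (Nat.eqb m 0); lia|].
    apply Crit. intros m. unfold shift_index. simpl Nat.eqb at 1.
    destruct (Nat.eqb_spec m 0) as [Em|Em].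
    { right; left. change (Nat.eqb (S (m / M)) 0) with false. cbv iota.
      rewrite Em, Nat.Div0.div_0_l. lia. }
    change (Nat.eqb (S (m / M)) 0) with false; cbv iota.
    destruct (Nat.eq_dec (m mod M) 0) as [Emod|Emod]; [|left; apply Hv0, Emod].
    assert (Dm := Nat.div_mod_eq m M).
    destruct (Nat.eq_dec M 2) as [EM|EM].
    + destruct (Nat.eq_dec m 2) as [E2|E2]; [left; rewrite E2; apply H2, EM|].
      right. assert (S (m / M) < m)%nat by (rewrite EM in *; lia). lia.
    + right. assert (Hlt : (S (m / M) < m)%nat).
      { rewrite Emod in Dm. destruct (m / M)%nat as [|q]; [lia|].
        assert (3 * S q <= M * S q)%nat by (apply Nat.mul_le_mono_r; lia). lia. }
      clear - Hlt. generalize dependent (m / M)%nat. lia.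
Qed.

Lemma shift_resolvent (a lam : C) (M : nat) :
  Cmod a < 1 -> (0 < M)%nat -> lam <> 0 -> (M = 2%nat -> lam <> Cmult 2 a) ->
  exists K, 0 <= K /\
    (forall c d A B, (forall m, Cmod (c m) <= A) -> (forall m, Cmod (d m) <= B) ->
      (forall m, shift_coef a M m * c (shift_index M m) - lam * c m = d m)%C ->
      forall m, Cmod (c m) <= K * B) /\
    (forall d B, (forall m, Cmod (d m) <= B) ->
      exists c, (exists A, forall m, Cmod (c m) <= A) /\
        forall m, (shift_coef a M m * c (shift_index M m) - lam * c m = d m)%C).
Proof.
  intros Ha HM Hlam H2.
  assert (Hl : 0 < Cmod lam) by (apply Cmod_gt_0, Hlam).
  (* For M = 2 the row m = 2 reads (2a - lam) c_2 = d_2. It is solved outright and gets v = 0, as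
     [shift_weights] demands; every other row is divided by lam. *)
  set (special := fun m => andb (Nat.eqb M 2) (Nat.eqb m 2)).
  set (v := fun m => if special m then RtoC 0 else (/ lam * shift_coef a M m)%C).
  set (u := fun (d : nat -> C) m => if special m then (/ (2 * a - lam) * d m)%C else (- / lam * d m)%C).
  assert (Hsp : forall m, special m = true -> M = 2%nat /\ m = 2%nat).
  { intros m Hm. unfold special in Hm. apply andb_prop in Hm.
    split; apply Nat.eqb_eq; apply Hm. }
  assert (Heq : forall c d m,
    (shift_coef a M m * c (shift_index M m) - lam * c m = d m)%C
    <-> (c m = u d m + v m * c (shift_index M m))%C).
  { intros c d m. unfold u, v. destruct (special m) eqn:Es.
    - destruct (Hsp m Es) as [E1 E2].
      assert (Hne : (2 * a - lam <> 0)%C).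
      { intros E. apply (H2 E1). replace lam with (2 * a - (2 * a - lam))%C by ring. rewrite E. ring. }
      rewrite E1, E2. change (shift_index 2 2) with 2%nat.
      rewrite shift_coef_2_2.
      split; intros E.
      + rewrite <- E. field. exact Hne.
      + replace (2 * a * c 2%nat - lam * c 2%nat)%C with ((2 * a - lam) * c 2%nat)%C by ring.
        rewrite E. field. exact Hne.
    - split; intros E.
      + rewrite <- E. field. exact Hlam.
      + rewrite E. field. exact Hlam. }
  destruct (shift_weights a M v (/ Cmod lam) Ha HM) as [kap [delta [kmax [W1 [W2 W3]]]]].
  { apply Rinv_0_lt_compat, Hl. }
  { intros m. unfold v. destruct (special m).
    - rewrite Cmod_0. apply Rmult_le_pos; [left; apply Rinv_0_lt_compat, Hl|apply Cmod_ge_0].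
    - rewrite Cmod_mult, Cmod_inv by exact Hlam. apply Rle_refl. }
  { intros E. unfold v, special. rewrite E. reflexivity. }
  (* For M <> 2 the difference 2a - lam may be 0; no row is then special, and the second summand is
     merely nonnegative. *)
  set (U := / Cmod lam + Cmod (/ (2 * a - lam))).
  assert (HU1 : 0 < / Cmod lam) by (apply Rinv_0_lt_compat, Hl).
  assert (HU2 := Cmod_ge_0 (/ (2 * a - lam))).
  assert (Hu : forall d B, (forall m, Cmod (d m) <= B) -> forall m, Cmod (u d m) <= U * B).
  { intros d B HB m. specialize (HB m). assert (D0 := Cmod_ge_0 (d m)).
    unfold u, U. destruct (special m); rewrite Cmod_mult.
    - apply Rmult_le_compat; lra.
    - rewrite Cmod_opp, Cmod_inv by exact Hlam. apply Rmult_le_compat; lra. }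
  assert (Hd : 0 < delta ^ kmax) by (apply pow_lt, W1).
  exists (2 * U / delta ^ kmax). split; [apply Rdiv_le_0_compat; [unfold U; lra|exact Hd]|]. split.
  - intros c d A B HA HB Hc m.
    replace (2 * U / delta ^ kmax * B) with (2 * (U * B) / delta ^ kmax) by (field; lra).
    apply (weighted_shift_bound (shift_index M) kap v delta kmax W1 W2 W3 c (u d) A (U * B) HA (Hu d B HB)).
    intros k. apply Heq, Hc.
  - intros d B HB.
    destruct (weighted_shift_solution (shift_index M) kap v delta kmax W1 W2 W3 (u d) (U * B) (Hu d B HB))
      as [c [HA Hc]].
    exists c. split; [exact HA|]. intros m. apply Heq, Hc.
Qed.

(** * The resolvent on S^p *)

(** Filling the gaps between the terms with zeros makes the partial sum up to m equal to the
    original one up to m / M, and m / M tends to infinity. *)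
Lemma is_series_sparse (M : nat) (b : nat -> C) (l : C) :
  (0 < M)%nat -> is_series (V := C_NormedModule) b l ->
  is_series (V := C_NormedModule)
    (fun m => if Nat.eqb (m mod M) 0 then b (m / M)%nat else RtoC 0) l.
Proof.
  intros HM Hb. set (s := fun m => if Nat.eqb (m mod M) 0 then b (m / M)%nat else RtoC 0).
  assert (E : forall m, sum_n (G := C_NormedModule) s m = sum_n (G := C_NormedModule) b (m / M)).
  { induction m as [|m IH].
    - rewrite Nat.Div0.div_0_l. rewrite !sum_O. unfold s.
      rewrite Nat.Div0.mod_0_l, Nat.Div0.div_0_l. reflexivity.
    - rewrite sum_Sn, IH.
      assert (D1 := Nat.div_mod_eq m M). assert (D2 := Nat.div_mod_eq (S m) M).
      assert (L1 := Nat.mod_upper_bound m M ltac:(lia)).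
      assert (L2 := Nat.mod_upper_bound (S m) M ltac:(lia)).
      unfold s. destruct (Nat.eqb_spec (S m mod M) 0) as [E0|E0].
      + assert (Q : (S m / M = S (m / M))%nat) by nia.
        rewrite Q, sum_Sn. reflexivity.
      + assert (Q : (S m / M = m / M)%nat) by nia.
        rewrite Q. exact (Cplus_0_r _). }
  apply is_series_C_iff. apply is_series_C_iff in Hb.
  apply is_lim_seq_ext with (fun m => Cmod (sum_n (G := C_NormedModule) b (m / M) - l)).
  { intros m. rewrite E. reflexivity. }
  apply (is_lim_seq_subseq (fun n => Cmod (sum_n (G := C_NormedModule) b n - l)) 0 (fun m => (m / M)%nat)).
  - intros P [n0 Hn0]. exists (n0 * M)%nat. intros m Hm. apply Hn0.
    apply Nat.div_le_lower_bound; lia.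
  - exact Hb.
Qed.

Lemma phi_sym_Cpow (a z : C) (M : nat) : phi_sym a M z = (a * Cpow z M)%C.
Proof. unfold phi_sym. f_equal. Qed.

Lemma phi_sym_disk (a z : C) (M : nat) : Cmod a < 1 -> in_disk z -> in_disk (phi_sym a M z).
Proof.
  unfold in_disk. intros Ha Hz. rewrite phi_sym_Cpow, Cmod_mult, Cmod_pow.
  assert (P : 0 <= Cmod z ^ M) by (apply pow_le, Cmod_ge_0).
  assert (P1 : Cmod z ^ M <= 1).
  { rewrite <- (pow1 M). apply pow_incr. split; [apply Cmod_ge_0|lra]. }
  assert (P2 := Cmod_ge_0 a). nra.
Qed.

(** Convertible with the operator inside [spectrum_Sp], so results about it apply there without
    rewriting. *)
Definition resolvent_op (a lam : C) (M : nat) (f : C -> C) : C -> C :=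
  fun z => Cminus (D_phi (phi_sym a M) f z) (Cmult lam (f z)).

(** Since a z^M stays in the disk, it can be put into the series of f'. The term (q+1) c_(q+1) (a
    z^M)^q sits at the exponent m = M q. *)
Lemma resolvent_op_has_ps (a lam : C) (M : nat) (f : C -> C) (c : nat -> C) :
  Cmod a < 1 -> (0 < M)%nat -> has_ps 1 f c ->
  has_ps 1 (resolvent_op a lam M f)
    (fun m => shift_coef a M m * c (shift_index M m) - lam * c m)%C.
Proof.
  intros Ha HM Hc. unfold resolvent_op.
  apply has_ps_minus with (g := fun z => (lam * f z)%C) (d := fun m => (lam * c m)%C);
    [|apply has_ps_scal, Hc].
  intros z Hz. assert (H := has_ps_Cderiv 1 f c Hc _ (phi_sym_disk a z M Ha Hz)).
  apply is_series_ext with (2 := is_series_sparse M _ _ HM H).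
  intros m. unfold shift_coef, shift_index.
  destruct (Nat.eqb_spec (m mod M) 0) as [E|E]; [|symmetry; rewrite !Cmult_0_l; reflexivity].
  rewrite phi_sym_Cpow, Cpow_mult_l, <- Cpow_mult_r.
  replace (M * (m / M))%nat with m by (generalize (Nat.div_mod_eq m M); lia).
  match goal with |- ?x = ?y => change (@eq C x y) end. unfold dcoef. ring.
Qed.

(** With [al] = |a|^(1/M) one has |a| |a|^(m/M) <= al^m, because integer division loses less than 1.
    The remaining factors are at most quadratic in m. *)
Lemma shift_coef_summable (a : C) (M : nat) :
  0 < Cmod a < 1 -> (0 < M)%nat ->
  ex_series (fun m => INR (S m) * Cmod (shift_coef a M (S m))).
Proof.
  intros Ha HM. assert (HM' : 0 < INR M) by (apply lt_0_INR, HM).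
  set (al := Rpower (Cmod a) (/ INR M)).
  assert (Hal0 : 0 < al) by apply exp_pos.
  assert (HalM : al ^ M = Cmod a).
  { rewrite <- Rpower_pow by exact Hal0. unfold al.
    rewrite Rpower_mult, Rinv_l by lra. apply Rpower_1. lra. }
  assert (Hal1 : al < 1).
  { destruct (Rlt_le_dec al 1) as [H|H]; [exact H|].
    assert (P := pow_R1_Rle al M H). lra. }
  assert (Hle : forall m, Cmod a * Cmod a ^ (m / M) <= al ^ m).
  { intros m. assert (D := Nat.div_mod_eq m M).
    assert (L := Nat.mod_upper_bound m M ltac:(lia)).
    rewrite D at 2. rewrite pow_add, pow_mult, HalM, Rmult_comm.
    apply Rmult_le_compat_l; [apply pow_le; lra|]. rewrite <- HalM.
    replace M with (m mod M + (M - m mod M))%nat at 1 by lia. rewrite pow_add.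
    assert (P1 : 0 < al ^ (m mod M)) by apply pow_lt, Hal0.
    assert (P2 : al ^ (M - m mod M) <= 1) by (rewrite <- (pow1 (M - m mod M)); apply pow_incr; lra).
    nra. }
  apply (ex_series_le (V := R_CompleteNormedModule)) with
    (fun m => / Cmod a * ((INR m + 1) * (INR m + 2) * al ^ m)).
  2: { apply (ex_series_scal (V := R_NormedModule) (/ Cmod a)), ex_series_quadratic_geom. lra. }
  intros m. change (Rabs (INR (S m) * Cmod (shift_coef a M (S m)))
    <= / Cmod a * ((INR m + 1) * (INR m + 2) * al ^ m)).
  assert (Hm := pos_INR m).
  rewrite Rabs_pos_eq by (apply Rmult_le_pos; [apply pos_INR|apply Cmod_ge_0]).
  apply Rmult_le_reg_l with (Cmod a); [lra|].
  replace (Cmod a * (/ Cmod a * ((INR m + 1) * (INR m + 2) * al ^ m)))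
    with ((INR m + 1) * ((INR m + 2) * al ^ m)) by (field; lra).
  replace (Cmod a * (INR (S m) * Cmod (shift_coef a M (S m))))
    with ((INR m + 1) * (Cmod a * Cmod (shift_coef a M (S m)))) by (rewrite S_INR; ring).
  apply Rmult_le_compat_l; [lra|].
  apply Rle_trans with ((INR (S m / M) + 1) * (Cmod a * Cmod a ^ (S m / M))).
  { rewrite <- Rmult_assoc, (Rmult_comm _ (Cmod a)), Rmult_assoc.
    apply Rmult_le_compat_l; [lra|apply Cmod_shift_coef_le]. }
  apply Rmult_le_compat.
  - generalize (pos_INR (S m / M)); lra.
  - apply Rmult_le_pos; [lra|apply pow_le; lra].
  - assert (Q : (S m / M <= S m)%nat) by (apply Nat.Div0.div_le_upper_bound; nia).
    apply le_INR in Q. rewrite S_INR in Q. lra.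
  - eapply Rle_trans; [apply Hle|]. simpl pow.
    assert (P1 : 0 < al ^ m) by apply pow_lt, Hal0. nra.
Qed.

Lemma has_ps_zero : has_ps 1 (fun _ => RtoC 0) (fun _ => RtoC 0).
Proof.
  destruct (has_ps_exists 1 (fun _ => RtoC 0)) as [f Hf].
  { intros s _. exists 0. intros n. rewrite Cmod_0. lra. }
  apply has_ps_ext with (fun z => (0 * f z)%C); [intros; ring|].
  apply has_ps_coef_ext with (fun n => (0 * 0)%C); [intros; ring|]. apply has_ps_scal, Hf.
Qed.

Lemma Mp_Cderiv_zero (p r : R) : 0 < r < 1 -> Mp p (Cderiv (fun _ => RtoC 0)) r = 0.
Proof.
  intros Hr. unfold Mp.
  rewrite (RInt_ext _ (fun _ => 0)), (RInt_const (V := R_CompleteNormedModule)).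
  { change (/ (2 * PI) * ((2 * PI - 0) * 0) = 0). ring. }
  intros t _. change (rpow (Cmod (Cderiv (fun _ => RtoC 0) (circ r t))) p = 0).
  assert (H := has_ps_cderiv_at 1 _ _ (circ r t) has_ps_zero (circ_in_disk r t Hr)).
  replace (Cderiv (fun _ => RtoC 0) (circ r t)) with (RtoC 0); [rewrite Cmod_0; apply rpow_0|].
  apply (cderiv_at_unique (fun _ => RtoC 0) (circ r t)); [|exact H].
  apply cderiv_at_iff. intros eps Heps. exists 1. split; [lra|]. intros y _.
  replace (0 - 0 - 0 * (y - circ r t))%C with (RtoC 0) by ring. rewrite Cmod_0.
  apply Rmult_le_pos; [lra|apply Cmod_ge_0].
Qed.

Lemma in_Sp_zero (p : R) : in_Sp p (fun _ => RtoC 0).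
Proof.
  split; [exact (has_ps_analytic _ _ has_ps_zero)|]. split.
  - exact (has_ps_analytic _ _ (has_ps_Cderiv _ _ _ has_ps_zero)).
  - exists 0. intros r Hr. rewrite Mp_Cderiv_zero by exact Hr. lra.
Qed.

Lemma Sp_norm_zero (p : R) : 0 < p -> Sp_norm p (fun _ => RtoC 0) = 0.
Proof.
  intros Hp. unfold Sp_norm. rewrite Cmod_0, Rplus_0_l.
  apply Rle_antisym; [|apply Hp_norm_ge_0]. apply Hp_norm_le; [exact Hp|lra|].
  intros r Hr. rewrite Mp_Cderiv_zero, rpow_0 by exact Hr. lra.
Qed.

Lemma resolvent_op_invertible (p : R) (a lam : C) (M : nat) :
  1 < p -> 0 < Cmod a < 1 -> (0 < M)%nat -> lam <> 0 -> (M = 2%nat -> lam <> Cmult 2 a) ->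
  invertible_on_Sp p (resolvent_op a lam M).
Proof.
  intros Hp Ha HM Hlam H2.
  assert (Hl : 0 < Cmod lam) by (apply Cmod_gt_0, Hlam).
  assert (HE0 : forall m, 0 <= Cmod (shift_coef a M m)) by (intros; apply Cmod_ge_0).
  assert (HEs := shift_coef_summable a M Ha HM).
  destruct (Sp_dominated p (- lam) _ Hp HE0 HEs) as [K1 [HK10 HK1]].
  destruct (Sp_dominated p (- / lam) _ Hp HE0 HEs) as [K2 [HK20 HK2]].
  destruct (shift_resolvent a lam M (proj2 Ha) HM Hlam H2) as [K3 [HK30 [Hbound Hsolve]]].
  assert (Hps := fun f c => resolvent_op_has_ps a lam M f c (proj2 Ha) HM).
  (* Here the deviation from -lam c_m is e_m c_(m/M+1), and the coefficients of [f] are at most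
     twice its norm. *)
  assert (HT : forall f, in_Sp p f -> in_Sp p (resolvent_op a lam M f)
    /\ Sp_norm p (resolvent_op a lam M f) <= K1 * (Sp_norm p f + 2 * Sp_norm p f)).
  { intros f Hf. destruct (in_Sp_has_ps p f Hf) as [c Hc].
    apply (HK1 f _ c _ (2 * Sp_norm p f)) with (4 := Hps f c Hc); try assumption.
    - generalize (Sp_norm_ge_0 p f); lra.
    - intros m.
      replace (shift_coef a M m * c (shift_index M m) - lam * c m - - lam * c m)%C
        with (c (shift_index M m) * shift_coef a M m)%C by ring.
      rewrite Cmod_mult. apply Rmult_le_compat_r; [apply HE0|].
      apply Sp_coef_le; assumption. }
  (* Regularity regained: c_m + d_m / lam = e_m c_(m/M+1) / lam, so bounded coefficients solving the
     recursion lie within a summable error of -g/lam. The bound does not involve [A]. *)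
  assert (HR : forall f g c d A, in_Sp p g -> has_ps 1 g d -> has_ps 1 f c ->
    (forall m, Cmod (c m) <= A) ->
    (forall m, shift_coef a M m * c (shift_index M m) - lam * c m = d m)%C ->
    in_Sp p f /\ Sp_norm p f <= K2 * (Sp_norm p g + K3 * (2 * Sp_norm p g) / Cmod lam)).
  { intros f g c d A Hg Hd Hc HA Hcd.
    assert (Hd' : forall m, Cmod (d m) <= 2 * Sp_norm p g) by (intros m; apply Sp_coef_le; assumption).
    assert (Hc' := Hbound c d A _ HA Hd' Hcd).
    apply (HK2 g f d c); try assumption.
    - apply Rdiv_le_0_compat; [|exact Hl]. apply Rmult_le_pos; [exact HK30|].
      generalize (Sp_norm_ge_0 p g); lra.
    - intros m. rewrite <- (Hcd m).
      replace (c m - - / lam * (shift_coef a M m * c (shift_index M m) - lam * c m))%C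
        with (/ lam * c (shift_index M m) * shift_coef a M m)%C by (field; exact Hlam).
      rewrite !Cmod_mult. apply Rmult_le_compat_r; [apply HE0|].
      rewrite Cmod_inv, Rmult_comm by exact Hlam. apply Rmult_le_compat_r; [|apply Hc'].
      left; apply Rinv_0_lt_compat, Hl. }
  split; [intros f Hf; apply HT, Hf|]. split; [|split].
  - exists (K1 * 3). intros f Hf. eapply Rle_trans; [apply HT, Hf|]. apply Req_le; ring.
  - exists (K2 * (1 + K3 * 2 / Cmod lam)). intros f Hf.
    destruct (in_Sp_has_ps p f Hf) as [c Hc].
    eapply Rle_trans.
    + apply (HR f (resolvent_op a lam M f) c _ (2 * Sp_norm p f) (proj1 (HT f Hf)) (Hps f c Hc) Hc).
      * intros m; apply Sp_coef_le; assumption.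
      * reflexivity.
    + apply Req_le. field. lra.
  (* Surjectivity: a bounded sequence always defines a function on the disk, and equal coefficients
     give equality with [g] there. *)
  - intros g Hg. destruct (in_Sp_has_ps p g Hg) as [d Hd].
    assert (Hd' : forall m, Cmod (d m) <= 2 * Sp_norm p g) by (intros m; apply Sp_coef_le; assumption).
    destruct (Hsolve d _ Hd') as [c [[A HA] Hcd]].
    destruct (has_ps_exists 1 c) as [f Hf].
    { intros s Hs. exists A. intros n. specialize (HA n). assert (C0 := Cmod_ge_0 (c n)).
      assert (P1 : s ^ n <= 1) by (rewrite <- (pow1 n); apply pow_incr; lra).
      assert (P0 : 0 <= s ^ n) by (apply pow_le; lra). nra. }
    exists f. split; [apply (HR f g c d A); assumption|].
    intros z Hz. apply (is_series_C_unique _ _ _ (Hps f c Hf z Hz)).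
    apply (has_ps_coef_ext 1 g d _ (fun m => eq_sym (Hcd m)) Hd z Hz).
Qed.

(** * Eigenvalues and the description of the spectrum *)

(** Comparison with the zero function puts the eigenfunction in S^p and shows that its image has
    norm 0. Boundedness below then forces its own norm to be 0, which the nonzero coefficient [c j]
    forbids. *)
Lemma eigenvector_not_invertible (p : R) (a lam : C) (M j : nat) (c : nat -> C) (A B : R) :
  1 < p -> 0 < Cmod a < 1 -> (0 < M)%nat -> 0 <= B ->
  (forall m, Cmod (c m) <= A) -> c j <> 0 ->
  (forall m, Cmod (c m) <= B * Cmod (shift_coef a M m)) ->
  (forall m, shift_coef a M m * c (shift_index M m) = lam * c m)%C ->
  ~ invertible_on_Sp p (resolvent_op a lam M).
Proof.
  intros Hp Ha HM HB HA Hj Hdom Heig [_ [_ [[K HK] _]]].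
  assert (HE0 : forall m, 0 <= Cmod (shift_coef a M m)) by (intros; apply Cmod_ge_0).
  destruct (Sp_dominated p 0 _ Hp HE0 (shift_coef_summable a M Ha HM)) as [K0 [HK00 HK0]].
  assert (Hz := Sp_norm_zero p ltac:(lra)).
  destruct (has_ps_exists 1 c) as [f Hf].
  { intros s Hs. exists A. intros n. specialize (HA n). assert (C0 := Cmod_ge_0 (c n)).
    assert (P1 : s ^ n <= 1) by (rewrite <- (pow1 n); apply pow_incr; lra).
    assert (P0 : 0 <= s ^ n) by (apply pow_le; lra). nra. }
  assert (HfS : in_Sp p f).
  { apply (HK0 (fun _ => RtoC 0) f (fun _ => RtoC 0) c B HB (in_Sp_zero p) has_ps_zero Hf).
    intros m. replace (c m - 0 * 0)%C with (c m) by ring. apply Hdom. }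
  assert (HTf : Sp_norm p (resolvent_op a lam M f) <= K0 * (0 + 0)).
  { rewrite <- Hz at 1.
    apply (HK0 (fun _ => RtoC 0) _ (fun _ => RtoC 0) _ 0 (Rle_refl 0) (in_Sp_zero p) has_ps_zero
      (resolvent_op_has_ps a lam M f c (proj2 Ha) HM Hf)).
    intros m. rewrite Heig. replace (lam * c m - lam * c m - 0 * 0)%C with (RtoC 0) by ring.
    rewrite Cmod_0. lra. }
  assert (T0 := Sp_norm_ge_0 p (resolvent_op a lam M f)).
  assert (T1 : Sp_norm p (resolvent_op a lam M f) = 0) by lra.
  specialize (HK f HfS). rewrite T1, Rmult_0_r in HK.
  assert (Hcj := Sp_coef_le p f c j Hp HfS Hf).
  assert (C0 : 0 < Cmod (c j)) by (apply Cmod_gt_0, Hj). lra.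
Qed.

Lemma zero_in_spectrum (p : R) (a : C) (M : nat) :
  1 < p -> 0 < Cmod a < 1 -> (0 < M)%nat ->
  ~ invertible_on_Sp p (resolvent_op a 0 M).
Proof.
  intros Hp Ha HM.
  (* The domination constant is 1 because the shift coefficient at 0 is 1. The shifted index is a
     successor, so it never hits the support {0}. *)
  apply (eigenvector_not_invertible p a 0 M 0 (fun m => if Nat.eqb m 0 then RtoC 1 else RtoC 0) 1 1);
    try assumption; try lra.
  - intros m. destruct (Nat.eqb m 0); rewrite ?Cmod_1, ?Cmod_0; lra.
  - exact C1_nz.
  - intros m. destruct (Nat.eqb_spec m 0) as [->|_].
    + unfold shift_coef. rewrite Nat.Div0.mod_0_l, Nat.Div0.div_0_l. simpl.
      rewrite Cmult_1_l, Cmod_1. lra.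
    + rewrite Cmod_0. generalize (Cmod_ge_0 (shift_coef a M m)); lra.
  - intros m. simpl. ring.
Qed.

Lemma two_a_in_spectrum (p : R) (a : C) :
  1 < p -> 0 < Cmod a < 1 -> ~ invertible_on_Sp p (resolvent_op a (Cmult 2 a) 2).
Proof.
  intros Hp Ha.
  assert (E2 := shift_coef_2_2 a).
  assert (N2 : Cmod (2 * a) = 2 * Cmod a) by (rewrite Cmod_mult, Cmod_R, Rabs_pos_eq; lra).
  (* The constant 1/(2|a|) is the inverse modulus of the shift coefficient at 2. *)
  apply (eigenvector_not_invertible p a (2 * a) 2 2 (fun m => if Nat.eqb m 2 then RtoC 1 else RtoC 0) 1
    (/ (2 * Cmod a))); try assumption; try lra; try lia.
  - left. apply Rinv_0_lt_compat. lra.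
  - intros m. destruct (Nat.eqb m 2); rewrite ?Cmod_1, ?Cmod_0; lra.
  - exact C1_nz.
  - intros m. destruct (Nat.eqb_spec m 2) as [->|_].
    + rewrite E2, N2, Cmod_1. apply Req_le. field. lra.
    + rewrite Cmod_0. apply Rmult_le_pos; [left; apply Rinv_0_lt_compat; lra|apply Cmod_ge_0].
  - intros m. unfold shift_index. destruct (Nat.eqb_spec m 2) as [->|Hm].
    + rewrite E2. change (Nat.eqb (S (2 / 2)) 2) with true. cbv iota. reflexivity.
    (* The index 3 is also sent to 2, but its shift coefficient vanishes because 3 is odd. *)
    + destruct (Nat.eqb_spec (S (m / 2)) 2) as [E|E]; [|ring].
      assert (Hm3 : m = 3%nat).
      { assert (D := Nat.div_mod_eq m 2). assert (L := Nat.mod_upper_bound m 2 ltac:(lia)). lia. }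
      rewrite Hm3. unfold shift_coef. simpl. ring.
Qed.

Theorem theorem4p2 (p : R) (a : C) (M : nat) :
  1 < p -> 0 < Cmod a < 1 -> (0 < M)%nat ->
  forall lam : C,
    spectrum_Sp p (D_phi (phi_sym a M)) lam <->
    (if Nat.eqb M 2 then lam = (0%R, 0%R) \/ lam = Cmult (2%R, 0%R) a
     else lam = (0%R, 0%R)).
Proof.
  intros Hp Ha HM lam. split.
  - intros Hs.
    destruct (excluded_middle_informative (lam = (0, 0))) as [H0|H0].
    { destruct (Nat.eqb M 2); [left|]; exact H0. }
    destruct (excluded_middle_informative (M = 2%nat /\ lam = Cmult (2, 0) a)) as [[HM2 H2]|H2].
    { rewrite HM2. right. exact H2. }
    exfalso. apply Hs. apply resolvent_op_invertible; try assumption.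
    intros HM2 E. apply H2. split; assumption.
  - destruct (Nat.eqb_spec M 2) as [HM2|_].
    + intros [->| ->]; [apply zero_in_spectrum; assumption|].
      rewrite HM2. apply two_a_in_spectrum; assumption.
    + intros ->. apply zero_in_spectrum; assumption.
Qed.
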